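(* Let $P=\operatorname{conv}(Gx)\subseteq\mathbb{R}^n$ be the Wythoffian polytope corresponding to a decoration $f : V(D) \to \{0,1\}$, where $D$ is the Coxeter diagram of the finite Coxeter group $G$. The face lattice of $P$ admits the following description. For $0\le k\le n$, the rank $k$ elements (the $k$-dimensional faces) are the pairs $(g, f')$ where $f'$ is a decorated Coxeter diagram obtained by applying the rule $(\star)$ to $f$ a total of $k$ times, and $g$ is an element of the coset space $G/G(f')$. The incidence structure is defined by the relation that, for $f'$ obtained by $k-1$ applications and $f''$ obtained by $k$ applications of $(\star)$ to $f$, the pair $(g,f'')$ contains $(g,f')$ if and only if $f''$ is obtained from $f'$ by one application of the rule $(\star)$. That is: the poset of nonempty faces of $P$ ordered by inclusion is isomorphic, with dimension corresponding to rank, to the graded poset of such pairs $(gG(f'), f')$, in which $(gG(f'),f')$ of rank $k-1$ is covered by $(hG(f''),f'')$ of rank $k$ if and only if $f''$ is obtained from $f'$ by one application of $(\star)$ and the two cosets have a common representative, i.e. $gG(f')\cap hG(f'')\neq\emptyset$.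
   Context: Setting. Let $n\ge 1$ and let $v_1,\dots,v_n\in\mathbb{R}^n$ be linearly independent unit vectors with $\langle v_i,v_j\rangle=-\cos(\pi/m_{ij})$, where $(m_{ij})$ is a symmetric matrix of positive integers with $m_{ii}=1$ and $m_{ij}\ge 2$ for $i\ne j$. Let $G\subseteq O(n)$ be the group generated by the reflections in the hyperplanes $v_i^\perp$, assumed finite; we also write $v_i$ for the reflection in $v_i^\perp$. The Coxeter diagram $D$ of $G$ is the graph with vertex set $V(D)=\{v_1,\dots,v_n\}$ in which $v_i,v_j$ ($i\neq j$) are adjacent when $m_{ij}\ge 3$, the edge being labelled $m_{ij}$. For a set $T$, a $T$-decorated Coxeter diagram (or decoration) is a map $V(D)\to T$. Wythoff's construction. Let $f:V(D)\to\{0,1\}$ be a decoration that is not identically $0$ on any connected component of $D$ (so that the resulting polytope is non-degenerate). Let $x$ be the unique unit vector in $\mathbb{R}^n$ such that $\langle v_i,x\rangle=0$ whenever $f(v_i)=0$ and $\langle v_i,x\rangle=c$ whenever $f(v_i)=1$, for a common constant $c>0$. The Wythoffian polytope corresponding to $f$ is $P=\operatorname{conv}(Gx)$. Rule $(\star)$. Regard $f$ as a $\{0,1,2\}$-decoration. Given a $\{0,1,2\}$-decoration $h$ and $w\in V(D)$ with $h(w)=1$, define a new decoration $h'$ by: $h'(v)=2$ exactly when $h(v)=2$ or $v=w$; $h'(v)=1$ exactly when ($h(v)=1$ and $v\ne w$) or ($h(v)=0$ and $v,w$ are adjacent in $D$); and $h'(v)=0$ otherwise. Then $h'$ is said to be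 obtained from $h$ by one application of $(\star)$ (on $w$). Different sequences of applications leading to the same decoration are identified. For a $\{0,1,2\}$-decoration $f'$, $G(f')$ denotes the subgroup of $G$ generated by those $v_i\in V(D)$ with $f'(v_i)\ne 1$. Faces: a face of $P$ is a set $P\cap\{y:c^Ty=c_0\}$ with $c^Ty\le c_0$ valid on $P$ ($P$ itself is a face, of dimension $n$); a $k$-face is a face whose affine hull has dimension $k$. The empty face is omitted from the description (it is the bottom element of the lattice). *)

(* Defs.v *)
From Stdlib Require Relation_Operators.
From mathcomp Require Import all_boot all_order all_algebra.
From mathcomp Require Import all_classical all_reals all_analysis.

Set Implicit Arguments.
Unset Strict Implicit.
Unset Printing Implicit Defensive.

Import Order.TTheory GRing.Theory Num.Theory.
Local Open Scope classical_set_scope.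
Local Open Scope ring_scope.

Definition dot (R : realType) (n : nat) (u w : 'cV[R]_n) : R :=
  \sum_i u i 0 * w i 0.

(* The norm that the library puts on matrices is the sup norm. *)
Definition enorm (R : realType) (n : nat) (u : 'cV[R]_n) : R :=
  Num.sqrt (dot u u).

(* Matrix of the reflection y |-> y - 2 <u, y> u in the hyperplane orthogonal
   to u; this formula is meant for unit vectors u only. *)
Definition reflection (R : realType) (n : nat) (u : 'cV[R]_n) : 'M[R]_n :=
  1%:M - 2 *: (u *m u^T).

Definition aff_hull (R : realType) (n : nat) (A : set 'cV[R]_n) : set 'cV[R]_n :=
  [set y | exists (k : nat) (a : 'I_k -> R) (z : 'I_k -> 'cV[R]_n),
    [/\ \sum_i a i = 1, forall i, A (z i) & y = \sum_i a i *: z i]].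

Definition conv_hull (R : realType) (n : nat) (A : set 'cV[R]_n) : set 'cV[R]_n :=
  [set y | exists (k : nat) (a : 'I_k -> R) (z : 'I_k -> 'cV[R]_n),
    [/\ forall i, 0 <= a i, \sum_i a i = 1, forall i, A (z i)
      & y = \sum_i a i *: z i]].

(* The affine hull of A is a translate of a k-dimensional linear subspace; the
   empty set has no dimension. *)
Definition has_aff_dim (R : realType) (n : nat) (A : set 'cV[R]_n) (k : nat) :
    Prop :=
  exists (p : 'cV[R]_n) (U : {vspace 'cV[R]_n}),
    aff_hull A = [set p + u | u in [set u | u \in U]] /\ \dim U = k.

Definition is_face (R : realType) (n : nat) (P F : set 'cV[R]_n) : Prop :=
  exists (c : 'cV[R]_n) (c0 : R),
    (forall y, P y -> dot c y <= c0) /\ F = P `&` [set y | dot c y = c0].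

Definition nonempty_faces (R : realType) (n : nat) (P : set 'cV[R]_n) :
    set (set 'cV[R]_n) :=
  [set F | is_face P F /\ F !=set0].

Definition mx_group (R : realType) (n : nat) (H : set 'M[R]_n) : Prop :=
  [/\ H 1%:M, forall A B, H A -> H B -> H (A *m B) & forall A, H A -> H (invmx A)].

Definition mx_generated (R : realType) (n : nat) (S : set 'M[R]_n) : set 'M[R]_n :=
  smallest (@mx_group R n) S.

Definition refl_group (R : realType) (n : nat) (v : 'I_n -> 'cV[R]_n)
    (J : set 'I_n) : set 'M[R]_n :=
  mx_generated [set reflection (v i) | i in J].

Definition left_coset (R : realType) (n : nat) (g : 'M[R]_n) (H : set 'M[R]_n) :
    set 'M[R]_n :=
  [set g *m h | h in H].

(* The vertex v_i of the diagram is encoded by its index i. *)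
Definition cox_adj (n : nat) (m : 'M[nat]_n) : rel 'I_n :=
  fun i j => (i != j) && (3 <= m i j)%N.

Definition decoration (n : nat) (T : Type) : Type := {ffun 'I_n -> T}.

Definition deco_nondegenerate (n : nat) (m : 'M[nat]_n) (f : decoration n 'I_2) : Prop :=
  forall i, exists j, connect (cox_adj m) i j /\ f j = 1%N :> nat.

Definition deco_lift (n : nat) (f : decoration n 'I_2) : decoration n 'I_3 :=
  [ffun i => widen_ord (isT : (2 <= 3)%N) (f i)].

Definition star_on (n : nat) (m : 'M[nat]_n) (h : decoration n 'I_3) (w : 'I_n) :
    decoration n 'I_3 :=
  [ffun i =>
     if (h i == 2%N :> nat) || (i == w) then inord 2
     else if ((h i == 1%N :> nat) && (i != w)) ||
             ((h i == 0%N :> nat) && cox_adj m i w) then inord 1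
     else inord 0].

Definition star_step (n : nat) (m : 'M[nat]_n) (h h' : decoration n 'I_3) : Prop :=
  exists w, h w = 1%N :> nat /\ h' = star_on m h w.

Fixpoint star_iter (n : nat) (m : 'M[nat]_n) (k : nat) (h h' : decoration n 'I_3) :
    Prop :=
  if k is k'.+1 then exists h1, star_iter m k' h h1 /\ star_step m h1 h'
  else h' = h.

Definition wythoff_point (R : realType) (n : nat) (v : 'I_n -> 'cV[R]_n)
    (f : decoration n 'I_2) (x : 'cV[R]_n) : Prop :=
  enorm x = 1 /\
  exists c : R, 0 < c /\
    forall i, (f i = 0%N :> nat -> dot (v i) x = 0) /\
              (f i = 1%N :> nat -> dot (v i) x = c).

Definition wythoff_polytope (R : realType) (n : nat) (v : 'I_n -> 'cV[R]_n)
    (x : 'cV[R]_n) : set 'cV[R]_n :=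
  conv_hull [set g *m x | g in refl_group v setT].

Definition deco_group (R : realType) (n : nat) (v : 'I_n -> 'cV[R]_n)
    (h : decoration n 'I_3) : set 'M[R]_n :=
  refl_group v [set i | h i <> 1%N :> nat].

(* A coset of G(f') is encoded as a set of matrices. *)
Definition wpair (R : realType) (n : nat) : Type :=
  (set 'M[R]_n * decoration n 'I_3)%type.

Definition wpairs_of_rank (R : realType) (n : nat) (v : 'I_n -> 'cV[R]_n)
    (m : 'M[nat]_n) (f : decoration n 'I_2) (k : nat) : set (wpair R n) :=
  [set p | star_iter m k (deco_lift f) p.2 /\
           exists2 g, refl_group v setT g & p.1 = left_coset g (deco_group v p.2)].

Definition wpairs (R : realType) (n : nat) (v : 'I_n -> 'cV[R]_n)
    (m : 'M[nat]_n) (f : decoration n 'I_2) : set (wpair R n) :=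
  [set p | exists2 k, (k <= n)%N & wpairs_of_rank v m f k p].

Definition wpair_cover (R : realType) (n : nat) (v : 'I_n -> 'cV[R]_n)
    (m : 'M[nat]_n) (f : decoration n 'I_2) (p q : wpair R n) : Prop :=
  exists k, [/\ wpairs_of_rank v m f k p, wpairs_of_rank v m f k.+1 q,
                star_step m p.2 q.2 & p.1 `&` q.1 !=set0].

Definition wpair_le (R : realType) (n : nat) (v : 'I_n -> 'cV[R]_n)
    (m : 'M[nat]_n) (f : decoration n 'I_2) : wpair R n -> wpair R n -> Prop :=
  Relation_Operators.clos_refl_trans _ (wpair_cover v m f).

(* It is b that covers a. *)
Definition order_cover (T : Type) (X : set T) (le : T -> T -> Prop) (a b : T) : Prop :=
  [/\ X a, X b, le a b, a <> b
    & forall c, X c -> le a c -> le c b -> c = a \/ c = b].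

(* Main.v *)
Require Import Defs.
From mathcomp Require Import all_boot all_order all_algebra.
From mathcomp Require Import all_classical all_reals all_analysis.
From mathcomp Require Import ring zify.

(** Everything rests on one fact about the vectors v_i: for every g in G the root
    g v_i is a combination of the v_j with coefficients all nonnegative or all
    nonpositive ([root_sign]).  This is where the special angles pi/m enter, through
    the rank two computation [alt_root] and the braid relation [alt_braid] that it
    yields; the passage from rank two to G is Tits' induction on word length
    ([ell_root_nonneg]).  Call y dominant when <v_i, y> >= 0 for all i.  As G
    is finite, every orbit contains a dominant vector ([orbit_dominant]).  Positivity of
    roots shows that y - g y is a nonnegative combination of the v_i when y is dominant
    ([dominant_sub]), and that the stabilizer of a dominant y is generated by the
    reflections in the v_i orthogonal to y ([dominant_stab]).  All three are proved for every parabolic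
    subgroup G_Y, generated by the reflections with index in Y.

    Faces.  A linear functional may be moved by G until it is dominant; it then
    attains its maximum on the orbit G x exactly at the points of G_J x, where J is the
    set of nodes orthogonal to the functional ([dominant_argmax]).  Hence the nonempty
    faces are the translates g F_J with F_J = conv(G_J x).  A node of J whose reflection
    fixes x and commutes with the other ones contributes nothing to F_J, and removing
    such nodes one arrives at a set that can be built node by node, each new node
    either moving x or being adjacent to an earlier one ([reachable_core]).  These
    reachable sets are exactly the sets of nodes of value 2 in the decorations produced
    by the rule: value 1 marks the nodes that may come next, and value 0 those whose
    reflections fix F_J pointwise, so that G(f') maps F_J to itself.  The same order of
    construction shows that F_J has all the directions v_j, j in J, so its dimension
    is the number of elements of J ([face_dim]).

    Incidence.  The heart is [face_subP]: g F_J lies in h F_K if and only if J is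
    contained in K and the cosets of g and h meet.  One first reduces to h = 1 and
    g x = x, then replaces g by an element of its double coset for which g v_j, j in J,
    and g^-1 v_k, k in K, are all nonnegative ([double_coset_min]).  As
    g F_J lies in F_K, the vector g v_j is a nonnegative combination of the v_k,
    k in K, and reading this relation backwards forces g v_j = v_k for one k.  Running
    through J in the order of its construction, g turns out to fix every v_j and to
    be a product of reflections in nodes of value 0 ([simple_rigid]), which says that
    J is contained in K and g is in G(f').  Injectivity of the labelling follows, and
    so do the statements about the order, because between two nested reachable sets
    there is always a next node to add ([reachable_next]). *)

Set Implicit Arguments.
Unset Strict Implicit.
Unset Printing Implicit Defensive.

Import Order.TTheory GRing.Theory Num.Theory.
Local Open Scope classical_set_scope.
Local Open Scope ring_scope.

(** * Scalar product, reflections, convex and affine hulls *)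

Section Euclid.
Variables (R : realType) (n : nat).
Implicit Types (u w y z c : 'cV[R]_n) (M : 'M[R]_n) (A : set 'cV[R]_n).

Lemma dotE u w : dot u w = (u^T *m w) 0 0.
Proof. by rewrite mxE; apply: eq_bigr => i _; rewrite mxE. Qed.

Lemma dotC u w : dot u w = dot w u.
Proof. by apply: eq_bigr => i _; rewrite mulrC. Qed.

Lemma dotDr u w y : dot u (w + y) = dot u w + dot u y.
Proof. by rewrite !dotE mulmxDr mxE. Qed.

Lemma dotZr (a : R) u w : dot u (a *: w) = a * dot u w.
Proof. by rewrite !dotE -scalemxAr mxE. Qed.

Lemma dotDl u w y : dot (u + w) y = dot u y + dot w y.
Proof. by rewrite !(dotC _ y) dotDr. Qed.

Lemma dotZl (a : R) u w : dot (a *: u) w = a * dot u w.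
Proof. by rewrite !(dotC _ w) dotZr. Qed.

Lemma dotNr u w : dot u (- w) = - dot u w.
Proof. by rewrite -scaleN1r dotZr mulN1r. Qed.

Lemma dotNl u w : dot (- u) w = - dot u w.
Proof. by rewrite !(dotC _ w) dotNr. Qed.

Lemma dotBr u w y : dot u (w - y) = dot u w - dot u y.
Proof. by rewrite dotDr dotNr. Qed.

Lemma dotBl u w y : dot (u - w) y = dot u y - dot w y.
Proof. by rewrite dotDl dotNl. Qed.

Lemma dot0r u : dot u 0 = 0.
Proof. by rewrite dotE mulmx0 mxE. Qed.

Lemma dot_sumr (I : Type) (r : seq I) (P : pred I) (F : I -> 'cV[R]_n) u :
  dot u (\sum_(i <- r | P i) F i) = \sum_(i <- r | P i) dot u (F i).
Proof. by elim/big_rec2: _ => [|i y a _ <-]; rewrite ?dot0r ?dotDr. Qed.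

Lemma dot_suml (I : Type) (r : seq I) (P : pred I) (F : I -> 'cV[R]_n) u :
  dot (\sum_(i <- r | P i) F i) u = \sum_(i <- r | P i) dot (F i) u.
Proof. by rewrite dotC dot_sumr; apply: eq_bigr => i _; rewrite dotC. Qed.

Lemma dot_mulmx M u w : dot (M *m u) w = dot u (M^T *m w).
Proof. by rewrite !dotE trmx_mul mulmxA. Qed.

Lemma dot_ge0 u : 0 <= dot u u.
Proof. by apply: sumr_ge0 => i _; rewrite -expr2 sqr_ge0. Qed.

Lemma dot_le0_eq0 u : dot u u <= 0 -> u = 0.
Proof.
move=> h; have /eqP : dot u u = 0 by apply/eqP; rewrite eq_le h dot_ge0.
rewrite psumr_eq0 => [/allP hu|i _]; last by rewrite -expr2 sqr_ge0.
apply/matrixP => i j; rewrite ord1 mxE; apply/eqP.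
by have := hu i (mem_index_enum _); rewrite /= mulf_eq0 orbb.
Qed.

Lemma reflectionE u y : reflection u *m y = y - (2 * dot u y) *: u.
Proof.
rewrite /reflection mulmxBl mul1mx -scalemxAl -mulmxA -scalerA; congr (_ - _ *: _).
by rewrite (mx11_scalar (u^T *m y)) mul_mx_scalar dotE.
Qed.

Lemma trmx_reflection u : (reflection u)^T = reflection u.
Proof. by rewrite /reflection linearB linearZ /= trmx1 trmx_mul trmxK. Qed.

Lemma reflectionK u y : dot u u = 1 -> reflection u *m (reflection u *m y) = y.
Proof.
move=> u1; rewrite !reflectionE dotBr dotZr u1.
by apply/matrixP => i j; rewrite !mxE; ring.
Qed.

Lemma mulmx_colP M M' : (forall y, M *m y = M' *m y) -> M = M'.
Proof.
move=> h; apply/matrixP => i j.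
have := congr1 (fun B : 'cV_n => B i 0) (h (delta_mx j 0)).
by rewrite -!colE !mxE.
Qed.

Lemma conv_hullS A B : A `<=` B -> conv_hull A `<=` conv_hull B.
Proof. by move=> AB y [k [a [z [a0 a1 Az ->]]]]; exists k, a, z; split=> // i; apply: AB. Qed.

Lemma sub_conv_hull A : A `<=` conv_hull A.
Proof.
move=> y Ay; exists 1, (fun=> 1), (fun=> y); split=> //; first by rewrite big_ord1.
by rewrite big_ord1 scale1r.
Qed.

Lemma conv_sub_aff A : conv_hull A `<=` aff_hull A.
Proof. by move=> y [k [a [z [_ a1 Az ->]]]]; exists k, a, z; split. Qed.

Lemma sub_aff_hull A : A `<=` aff_hull A.
Proof. by move=> y /sub_conv_hull/conv_sub_aff. Qed.

Lemma conv_hull_img M A :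
  conv_hull [set M *m z | z in A] = [set M *m z | z in conv_hull A].
Proof.
apply/seteqP; split=> y.
  move=> [k [a [z [a0 a1 Az ->]]]].
  have /choice[t ht] : forall i, exists z', A z' /\ M *m z' = z i.
    by move=> i; have [z' Az' e] := Az i; exists z'.
  exists (\sum_i a i *: t i).
    by exists k, a, t; split=> // i; case: (ht i).
  rewrite mulmx_sumr; apply: eq_bigr => i _.
  by rewrite -scalemxAr; case: (ht i) => _ ->.
move=> [_ [k [a [z [a0 a1 Az ->]]]] <-].
exists k, a, (fun i => M *m z i); split=> //; first by move=> i; exists (z i).
by rewrite mulmx_sumr; apply: eq_bigr => i _; rewrite -scalemxAr.
Qed.

Lemma aff_hull_img M A :
  [set M *m z | z in aff_hull A] `<=` aff_hull [set M *m z | z in A].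
Proof.
move=> y [_ [k [a [z [a1 Az ->]]]] <-].
exists k, a, (fun i => M *m z i); split=> //; first by move=> i; exists (z i).
by rewrite mulmx_sumr; apply: eq_bigr => i _; rewrite -scalemxAr.
Qed.

Lemma dot_conv_le A c (b : R) :
  (forall z, A z -> dot c z <= b) -> forall y, conv_hull A y -> dot c y <= b.
Proof.
move=> h y [k [a [z [a0 a1 Az ->]]]]; rewrite dot_sumr -[b]mul1r -a1 mulr_suml.
by apply: ler_sum => i _; rewrite dotZr ler_wpM2l // h.
Qed.

Lemma dot_aff_eq A c (b : R) :
  (forall z, A z -> dot c z = b) -> forall y, aff_hull A y -> dot c y = b.
Proof.
move=> h y [k [a [z [a1 Az ->]]]]; rewrite dot_sumr -[b]mul1r -a1 mulr_suml.
by apply: eq_bigr => i _; rewrite dotZr h.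
Qed.

(** In a convex combination lying on a supporting hyperplane, every point of nonzero
    weight lies on that hyperplane. *)
Lemma conv_hull_face A c (b : R) : (forall z, A z -> dot c z <= b) ->
  conv_hull A `&` [set y | dot c y = b] = conv_hull (A `&` [set y | dot c y = b]).
Proof.
move=> h; apply/seteqP; split=> y; last first.
  move=> hy; split; first by apply: conv_hullS hy => z [].
  by apply: (dot_aff_eq _ (conv_sub_aff hy)) => z [].
move=> [[k [a [z [a0 a1 Az ->]]]] /= e].
have tight i : a i != 0 -> dot c (z i) = b.
  have : \sum_i a i * (b - dot c (z i)) == 0.
    rewrite (eq_bigr (fun i => a i * b - dot c (a i *: z i))) => [|j _]; last first.
      by rewrite dotZr mulrBr.
    by rewrite sumrB -mulr_suml a1 mul1r -dot_sumr e subrr.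
  rewrite psumr_eq0 => [/allP /(_ i (mem_index_enum _)) /=|j _]; last first.
    by rewrite mulr_ge0 // subr_ge0 h.
  by rewrite mulf_eq0 => /orP[->//|]; rewrite subr_eq0 => /eqP.
have [i0 ai0] : exists i, a i != 0.
  apply/existsP; rewrite -negb_forall; apply/negP => /forallP a00.
  have : \sum_i a i = 0 by apply: big1 => i _; apply/eqP/a00.
  by rewrite a1 => /eqP; rewrite oner_eq0.
(* points of weight zero may lie off the face and are replaced by one of positive weight *)
exists k, a, (fun i => if a i == 0 then z i0 else z i); split=> //.
  by move=> i; case: ifPn => ai; split=> //=; apply: tight.
by apply: eq_bigr => i _; case: ifP => // /eqP ->; rewrite !scale0r.
Qed.

(** The two families of points are concatenated by indexing them with 'I_(k + l). *)
Lemma aff_hull_line A y z (t : R) :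
  aff_hull A y -> aff_hull A z -> aff_hull A (t *: y + (1 - t) *: z).
Proof.
move=> [k [a [p [a1 Ap ->]]]] [l [b [q [b1 Aq ->]]]].
pose a' i := match fintype.split i with inl i => t * a i | inr i => (1 - t) * b i end.
pose p' i := match fintype.split i with inl i => p i | inr i => q i end.
have el i : fintype.split (lshift l i) = inl i :> 'I_k + 'I_l by rewrite (unsplitK (inl i)).
have er i : fintype.split (rshift k i) = inr i :> 'I_k + 'I_l by rewrite (unsplitK (inr i)).
exists (k + l)%N, a', p'; split.
- rewrite big_split_ord /=.
  rewrite (eq_bigr (fun i => t * a i)) => [|i _]; last by rewrite /a' el.
  rewrite [X in _ + X](eq_bigr (fun i => (1 - t) * b i)) => [|i _]; last by rewrite /a' er.
  by rewrite -!mulr_sumr a1 b1; ring.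
- by move=> i; rewrite /p'; case: fintype.split.
- rewrite big_split_ord /= !scaler_sumr; congr (_ + _); apply: eq_bigr => i _.
    by rewrite /a' /p' el scalerA.
  by rewrite /a' /p' er scalerA.
Qed.

Lemma aff_hull_shift A y z z' (t : R) : aff_hull A y -> aff_hull A z ->
  aff_hull A z' -> aff_hull A (y + t *: (z - z')).
Proof.
move=> hy hz hz'.
have := aff_hull_line (1 / 2) (aff_hull_line (2 * t) hz hy) (aff_hull_line (1 + 2 * t) hy hz').
congr aff_hull; apply/matrixP => i j; rewrite !mxE; by field.
Qed.

End Euclid.

Lemma finite_argmax (R : realDomainType) (T : choiceType) (A : set T) (p : T -> R) :
  finite_set A -> A !=set0 ->
  exists2 a, A a & forall b, A b -> p b <= p a.
Proof.
move=> /finite_seqP[r ->] [a0 /= a0r].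
have : r != [::] by apply/eqP => r0; rewrite r0 in a0r.
elim: r {a0 a0r} => // a r IH _; have [->|/IH[b /= br hb]] := eqVneq r [::].
  by exists a => [|b] /=; rewrite ?mem_head // inE => /eqP->.
have [ab|/ltW ba] := leP (p a) (p b).
  exists b => [|c /=]; first by rewrite /= inE br orbT.
  by rewrite inE => /orP[/eqP->//|/hb].
exists a => [|c /=]; first by rewrite /= mem_head.
by rewrite inE => /orP[/eqP->//|/hb h]; apply: le_trans ba.
Qed.

(** * Words, parabolic subgroups and length *)

Section Coxeter.
Variables (R : realType) (n : nat) (v : 'I_n -> 'cV[R]_n).
Hypothesis v_unit : forall i, enorm (v i) = 1.
Implicit Types (J K L Y Z : {set 'I_n}) (r : seq 'I_n) (g h : 'M[R]_n) (c y z : 'cV[R]_n).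
Local Notation s i := (reflection (v i)).
Local Notation full := [set: 'I_n]%SET.

Definition wprod r : 'M[R]_n := foldr (fun i M => reflection (v i) *m M) 1%:M r.

(** Taking products of words as the definition makes length available; the equality with
    the generated matrix group is [refl_groupE]. *)
Definition parabolic Y : set 'M[R]_n := [set wprod r | r in [set r : seq _ | {subset r <= Y}]].

Lemma dot_root i : dot (v i) (v i) = 1.
Proof.
have := v_unit i; rewrite /enorm => h.
by rewrite -(sqr_sqrtr (dot_ge0 (v i))) h expr1n.
Qed.

Lemma refl_sq i : reflection (v i) *m reflection (v i) = 1%:M.
Proof.
by apply: mulmx_colP => y; rewrite -mulmxA reflectionK ?dot_root // mul1mx.
Qed.

Lemma refl_root i : reflection (v i) *m v i = - v i.
Proof.
by rewrite reflectionE dot_root; apply/matrixP => a b; rewrite !mxE; ring.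
Qed.

Lemma wprod_cat r r' : wprod (r ++ r') = wprod r *m wprod r'.
Proof. by elim: r => [|i r /= ->]; rewrite /= ?mul1mx ?mulmxA. Qed.

Lemma wprod1 i : wprod [:: i] = reflection (v i).
Proof. by rewrite /= mulmx1. Qed.

Lemma wprod_rcons r i : wprod (rcons r i) = wprod r *m reflection (v i).
Proof. by rewrite -cats1 wprod_cat wprod1. Qed.

Lemma wprod_rev r : wprod (rev r) = (wprod r)^T.
Proof.
elim: r => [|i r IH]; first by rewrite /= trmx1.
by rewrite rev_cons wprod_rcons IH /= trmx_mul trmx_reflection.
Qed.

Lemma wprod_trK r : (wprod r)^T *m wprod r = 1%:M.
Proof.
elim: r => [|i r IH]; first by rewrite /= trmx1 mul1mx.
by rewrite /= trmx_mul trmx_reflection -mulmxA (mulmxA (reflection _)) refl_sq mul1mx.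
Qed.

Lemma para_wprod Y r : {subset r <= Y} -> parabolic Y (wprod r).
Proof. by exists r. Qed.

Lemma para1 Y : parabolic Y 1%:M.
Proof. by exists [::]. Qed.

Lemma paraM Y g h : parabolic Y g -> parabolic Y h -> parabolic Y (g *m h).
Proof.
move=> [r rY <-] [r' rY' <-]; exists (r ++ r'); rewrite ?wprod_cat //.
by move=> i; rewrite mem_cat => /orP[/rY|/rY'].
Qed.

Lemma para_refl Y i : i \in Y -> parabolic Y (reflection (v i)).
Proof. by move=> iY; exists [:: i]; rewrite ?wprod1 // => j; rewrite inE => /eqP->. Qed.

Lemma paraV Y g : parabolic Y g -> parabolic Y g^T.
Proof.
by move=> [r rY <-]; exists (rev r); rewrite ?wprod_rev // => i; rewrite mem_rev => /rY.
Qed.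

Lemma paraS Y Z g : Y \subset Z -> parabolic Y g -> parabolic Z g.
Proof. by move=> /fintype.subsetP YZ [r rY <-]; exists r => // i /rY/YZ. Qed.

Lemma para_trK Y g : parabolic Y g -> g^T *m g = 1%:M.
Proof. by move=> [r _ <-]; apply: wprod_trK. Qed.

Lemma para_trKr Y g : parabolic Y g -> g *m g^T = 1%:M.
Proof. by move=> /paraV/para_trK; rewrite trmxK. Qed.

Lemma para_dot Y g y z : parabolic Y g -> dot (g *m y) (g *m z) = dot y z.
Proof. by move=> Yg; rewrite dot_mulmx mulmxA (para_trK Yg) mul1mx. Qed.

Lemma para_conj Y g i : parabolic Y g ->
  g *m reflection (v i) = reflection (g *m v i) *m g.
Proof.
move=> Yg; apply: mulmx_colP => y.
by rewrite -!mulmxA !reflectionE (para_dot _ _ Yg) mulmxBr -scalemxAr.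
Qed.

(** Used for the fundamental weights outside Y and for the functionals that expose a face:
    both are orthogonal to the v_i with i in Y. *)
Lemma para_fix Y g y : parabolic Y g -> (forall i, i \in Y -> dot (v i) y = 0) ->
  g *m y = y.
Proof.
move=> [r rY <-] h; elim: r rY => [|i r IH] rY; first by rewrite /= mul1mx.
rewrite /= -mulmxA IH => [|j jw]; last by rewrite rY // inE jw orbT.
by rewrite reflectionE h ?mulr0 ?scale0r ?subr0 // rY // mem_head.
Qed.

Lemma refl_groupE Y (J : set 'I_n) : (forall i, J i <-> i \in Y) ->
  refl_group v J = parabolic Y.
Proof.
move=> JY; apply/seteqP; split.
  apply: smallest_sub; last by move=> _ [i /JY iY <-]; apply: para_refl.
  split; [exact: para1 | exact: paraM | move=> g Yg].
  have /mulmx1_unit[_ gu] := para_trK Yg.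
  by rewrite -[invmx g]mul1mx -(para_trK Yg) mulmxK //; apply: paraV.
move=> _ [r rY <-] G [[G1 GM _] Gs]; elim: r rY => [|i r IH] rY //=.
apply: GM; last by apply: IH => j jw; apply: rY; rewrite inE jw orbT.
by apply: Gs; exists i => //; apply/JY/rY; rewrite mem_head.
Qed.

(** Word length with respect to the generators indexed by Y only, as the positivity
    theorem is needed inside every parabolic subgroup; the default value 0 is taken
    outside G_Y. *)
Definition ell Y g : nat :=
  xget 0%N [set k | (exists r, [/\ {subset r <= Y}, wprod r = g & size r = k]) /\
                 forall r, {subset r <= Y} -> wprod r = g -> (k <= size r)%N].

Lemma ellP Y g : parabolic Y g ->
  (exists r, [/\ {subset r <= Y}, wprod r = g & size r = ell Y g]) /\
  forall r, {subset r <= Y} -> wprod r = g -> (ell Y g <= size r)%N.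
Proof.
move=> [r0 r0Y e0]; rewrite /ell; case: xgetP => [k _ []//|none].
pose Q k := `[< exists r, [/\ {subset r <= Y}, wprod r = g & size r = k] >].
have exQ : exists k, Q k by exists (size r0); apply/asboolP; exists r0.
case: (ex_minnP exQ) => k /asboolP hk kmin; case: (none k); split=> // r rY e.
by apply: kmin; apply/asboolP; exists r.
Qed.

Lemma ell_word Y r : {subset r <= Y} -> (ell Y (wprod r) <= size r)%N.
Proof.
move=> rY; have Yw := para_wprod rY.
by have [_] := ellP Yw; apply.
Qed.

Lemma ell_mulr Y g r : parabolic Y g -> {subset r <= Y} ->
  (ell Y (g *m wprod r) <= ell Y g + size r)%N.
Proof.
move=> Yg rY; have [[r' [r'Y <- <-]] _] := ellP Yg.
rewrite -wprod_cat -size_cat; have Yw : {subset r' ++ r <= Y}.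
  by move=> i; rewrite mem_cat => /orP[/r'Y|/rY].
exact: ell_word.
Qed.

Lemma ell_mul_refl Y g i : parabolic Y g -> i \in Y ->
  (ell Y (g *m reflection (v i)) <= (ell Y g).+1)%N.
Proof.
by move=> Yg iY; rewrite -wprod1 -addn1 ell_mulr // => j; rewrite inE => /eqP->.
Qed.

Lemma ell_mul_refl_ge Y g i : parabolic Y g -> i \in Y ->
  (ell Y g <= (ell Y (g *m reflection (v i))).+1)%N.
Proof.
move=> Yg iY; rewrite -{1}[g]mulmx1 -(refl_sq i) mulmxA; apply: ell_mul_refl => //.
by apply: paraM => //; apply: para_refl.
Qed.

(** * Coordinates in the basis of simple roots *)

Variable m : 'M[nat]_n.
Hypothesis v_free : free [seq v i | i <- enum 'I_n].
Hypothesis m_sym : forall i j, m i j = m j i.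
Hypothesis m_offdiag : forall i j : 'I_n, i != j -> (2 <= m i j)%N.
Hypothesis v_dot : forall i j, dot (v i) (v j) = - cos (pi / (m i j)%:R).

Definition root_mx : 'M[R]_n := \matrix_(i, k) v i k 0.
(** The basis dual to v, i.e. the fundamental weights: <y, weight j> is the coordinate of y
    along v_j. *)
Definition weight (j : 'I_n) : 'cV[R]_n := col j (invmx root_mx).

Lemma root_mx_unit : root_mx \in unitmx.
Proof.
rewrite -row_free_unit; apply: inj_row_free => a a0.
have e : [tuple v i | i < n] = [seq v i | i <- enum 'I_n] :> seq _.
  by rewrite -val_ord_tuple.
have /freeP fr : free [tuple v i | i < n] by rewrite e.
apply/matrixP => i j; rewrite ord1 mxE; apply: (fr (fun i => a 0 i)).
under eq_bigr do rewrite -tnth_nth tnth_mktuple.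
apply/matrixP => k l; rewrite ord1.
have := congr1 (fun B : 'rV_n => B 0 k) a0; rewrite !mxE => <-.
by rewrite summxE; apply: eq_bigr => i' _; rewrite !mxE.
Qed.

Lemma dot_weight i j : dot (v i) (weight j) = (i == j)%:R.
Proof.
have := congr1 (fun B : 'M[R]_n => B i j) (mulmxV root_mx_unit); rewrite !mxE => <-.
by apply: eq_bigr => k _; rewrite !mxE.
Qed.

Lemma weight_decomp y : y = \sum_j dot y (weight j) *: v j.
Proof.
have /(congr1 trmx) := mulVmx root_mx_unit; rewrite trmx_mul trmx1 => e.
rewrite -{1}[y]mul1mx -e -mulmxA; apply/matrixP => k l; rewrite ord1 mxE summxE.
apply: eq_bigr => j _; rewrite !mxE mulrC; congr (_ * _).
by apply: eq_bigr => i _; rewrite !mxE mulrC.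
Qed.

Lemma weight_inj y z : (forall j, dot y (weight j) = dot z (weight j)) -> y = z.
Proof.
by move=> h; rewrite (weight_decomp y) (weight_decomp z); apply: eq_bigr => j _; rewrite h.
Qed.

Definition nonneg y := forall j, 0 <= dot y (weight j).

Lemma nonnegD y z : nonneg y -> nonneg z -> nonneg (y + z).
Proof. by move=> hy hz j; rewrite dotDl addr_ge0. Qed.

Lemma nonnegZ (a : R) y : 0 <= a -> nonneg y -> nonneg (a *: y).
Proof. by move=> a0 hy j; rewrite dotZl mulr_ge0. Qed.

Lemma nonneg_root i : nonneg (v i).
Proof. by move=> j; rewrite dot_weight ler0n. Qed.

Lemma nonneg0 : nonneg 0.
Proof. by move=> j; rewrite dotC dot0r. Qed.

Lemma nonneg_anti y : nonneg y -> nonneg (- y) -> y = 0.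
Proof.
move=> hy hN; apply: weight_inj => j; rewrite [RHS]dotC dot0r.
by apply/eqP; rewrite eq_le hy andbT; have := hN j; rewrite dotNl oppr_ge0.
Qed.

Lemma nonneg_dot y z : nonneg y -> (forall i, 0 <= dot (v i) z) -> 0 <= dot y z.
Proof.
move=> hy hz; rewrite (weight_decomp y) dot_suml; apply: sumr_ge0 => j _.
by rewrite dotZl mulr_ge0.
Qed.

Lemma para_weight Y g j : parabolic Y g -> j \notin Y -> g *m weight j = weight j.
Proof.
move=> Yg jY; apply: (para_fix Yg) => i iY; rewrite dot_weight.
by case: eqP => // ij; rewrite ij (negbTE jY) in iY.
Qed.

Lemma para_dot_weight Y g y j : parabolic Y g -> j \notin Y ->
  dot (g *m y) (weight j) = dot y (weight j).
Proof. by move=> Yg jY; rewrite dot_mulmx (para_weight (paraV Yg)). Qed.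

(** * Positivity of roots *)

Section Dihedral.
Variables i j : 'I_n.
Hypothesis ij : i != j.

Let x k := if odd k then j else i.

(** The alternating word of length k that ends with j, so that it acts on v_i
    without cancelling; x k is its first letter. *)
Fixpoint alt k : seq 'I_n := if k is k'.+1 then x k'.+1 :: alt k' else [::].

Lemma size_alt k : size (alt k) = k.
Proof. by elim: k => //= k ->. Qed.

Lemma alt_sub Y k : i \in Y -> j \in Y -> {subset alt k <= Y}.
Proof.
move=> iY jY; elim: k => [|k IH] l //; rewrite inE => /orP[/eqP->|/IH//].
by rewrite /x; case: ifP.
Qed.

Let t : R := pi / (m i j)%:R.

Lemma dot_x k : dot (v (x k.+1)) (v (x k)) = - cos t.
Proof. by rewrite /x /=; case: odd => /=; rewrite v_dot // m_sym. Qed.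

(** The classical formula for the roots of a dihedral group, multiplied by sin t to avoid
    quotients; the induction step is the addition formula for the sine. *)
Lemma alt_root k : sin t *: (wprod (alt k) *m v i) =
  sin (k.+1%:R * t) *: v (x k) + sin (k%:R * t) *: v (x k.+1).
Proof.
elim: k => [|k IH]; first by rewrite /= mul1mx mul1r mul0r sin0 scale0r addr0.
rewrite [alt k.+1]/= [wprod (_ :: _)]/= -mulmxA scalemxAr IH mulmxDr -!scalemxAr.
rewrite refl_root // reflectionE dot_x (_ : x k.+2 = x k); last by rewrite /x /= negbK.
have -> : sin (k.+2%:R * t) = 2 * cos t * sin (k.+1%:R * t) - sin (k%:R * t).
  have -> : k.+2%:R * t = k.+1%:R * t + t by rewrite -[k.+2]addn1 natrD mulrDl mul1r.
  have -> : k%:R * t = k.+1%:R * t - t by rewrite -[k.+1]addn1 natrD mulrDl mul1r addrK.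
  by rewrite sinB sinD; ring.
by apply/matrixP => a b; rewrite !mxE; ring.
Qed.

Let m0 : 0 < (m i j)%:R :> R.
Proof. by rewrite ltr0n; apply: leq_trans (m_offdiag ij). Qed.

Let mt : (m i j)%:R * t = pi.
Proof. by rewrite /t mulrC divfK // gt_eqF. Qed.

Let sint : 0 < sin t.
Proof.
apply: sin_gt0_pi; rewrite divr_gt0 ?pi_gt0 //= -[ltRHS]mt -[ltLHS]mul1r.
rewrite ltr_pM2r ?ltr1n ?divr_gt0 ?pi_gt0 //; exact: m_offdiag.
Qed.

Let sinkt k : (k <= m i j)%N -> 0 <= sin (k%:R * t).
Proof.
move=> km; apply: sin_ge0_pi; rewrite mulr_ge0 ?divr_ge0 ?pi_ge0 ?ler0n //=.
by rewrite -[leRHS]mt ler_wpM2r ?ler_nat // divr_ge0 ?pi_ge0 ?ler0n.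
Qed.

(** As long as k < m, both angles in [alt_root] lie between 0 and pi. *)
Lemma alt_root_nonneg k g : (k < m i j)%N -> nonneg (g *m v i) -> nonneg (g *m v j) ->
  nonneg (g *m (wprod (alt k) *m v i)).
Proof.
move=> km gi gj; have := alt_root k => /(congr1 (fun y => g *m ((sin t)^-1 *: y))).
rewrite scalerA mulVf ?gt_eqF // scale1r => ->.
have gx l : nonneg (g *m v (x l)) by rewrite /x; case: odd.
rewrite -scalemxAr mulmxDr -!scalemxAr; apply: nonnegZ.
  by rewrite invr_ge0 ltW.
by apply: nonnegD; apply: nonnegZ => //; apply: sinkt => //; apply: ltnW.
Qed.

(** For k = m - 1 the formula [alt_root] gives a simple root, and conjugation by the
    alternating word turns one simple reflection into the other.  This replaces a
    computation with the two words of length m. *)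
Lemma alt_braid : wprod (alt (m i j)) *m s i = wprod (alt (m i j).-1).
Proof.
have m1 : (m i j).-1.+1 = m i j by rewrite prednK //; apply: leq_trans (m_offdiag ij).
rewrite -{1}m1 /= -mulmxA.
have Ya : parabolic full (wprod (alt (m i j).-1)).
  by apply: para_wprod => l _; rewrite finset.in_setT.
have e : wprod (alt (m i j).-1) *m v i = v (x (m i j)).
  have := alt_root (m i j).-1; rewrite m1 mt sinpi scale0r add0r.
  have -> : (m i j).-1%:R * t = pi - t.
    by rewrite -mt -[in (m i j)%:R]m1 -addn1 natrD mulrDl mul1r addrK.
  rewrite sinB sinpi cospi mul0r add0r mulN1r opprK.
  by apply: scalerI; rewrite gt_eqF.
by rewrite (para_conj _ Ya) e m1 mulmxA refl_sq // mul1mx.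
Qed.

End Dihedral.

(** Tits' argument.  Let g end with the letter j of a shortest word.  Peel the letters
    j, i, j, ... off the right end of g as long as the length drops, l letters in all.  What
    remains, u l, is not shortened by i or j, so by induction it maps v_i and v_j to
    nonnegative vectors.  If l < m, the peeled word maps v_i to a nonnegative combination
    of v_i and v_j; if l >= m, the braid relation would make g s_i shorter than g. *)
Lemma ell_root_nonneg Y g i : parabolic Y g -> i \in Y ->
  (ell Y g <= ell Y (g *m s i))%N -> nonneg (g *m v i).
Proof.
have [k] := ubnP (ell Y g); elim: k => // k IH in g i *; rewrite ltnS => gk Yg iY gi.
have [[r [rY ew sw]] _] := ellP Yg.
case: (lastP r) rY ew sw => [|r0 j] rY ew sw.
  by rewrite -ew /= mul1mx; apply: nonneg_root.
have jY : j \in Y by apply: rY; rewrite mem_rcons mem_head.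
have lj : ((ell Y (g *m s j)).+1 <= ell Y g)%N.
  rewrite -sw size_rcons ltnS -ew wprod_rcons -mulmxA refl_sq // mulmx1.
  have r0Y : {subset r0 <= Y} by move=> l lw; apply: rY; rewrite mem_rcons inE lw orbT.
  exact: ell_word.
have ij : i != j by apply/eqP => ij; rewrite ij in gi; lia.
pose x l := if odd l then j else i.
have xY l : x l \in Y by rewrite /x; case: odd.
pose u l := g *m (wprod (alt i j l))^T.
have Ya l : {subset alt i j l <= Y} by apply: alt_sub.
have Yu l : parabolic Y (u l) by apply: paraM => //; apply/paraV/para_wprod.
have u1 : u 1%N = g *m s j by rewrite /u /= mulmx1 trmx_reflection.
have uS l : u l.+1 = u l *m s (x l.+1) by rewrite /u /= trmx_mul trmx_reflection mulmxA.
have gu l : g = u l *m wprod (alt i j l) by rewrite /u -mulmxA wprod_trK mulmx1.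
clearbody u.
have uP l : u l = u l.+1 *m s (x l.+1) by rewrite uS -mulmxA refl_sq mulmx1.
have lu l d : (ell Y (u l) <= ell Y (u (l + d)%N) + d)%N.
  elim: d => [|d /leq_trans]; first by rewrite !addn0.
  by apply; rewrite !addnS -addSn leq_add2r uS ell_mul_refl_ge.
have lg l : (ell Y g <= ell Y (u l) + l)%N.
  by have := ell_mulr (Yu l) (Ya l); rewrite -gu size_alt.
pose Q l := (ell Y (u l) + l == ell Y g)%N.
have Q1 : Q 1%N by rewrite /Q eqn_leq lg andbT addn1 u1.
have exQ : exists l, Q l by exists 1%N.
have Qb l : Q l -> (l <= ell Y g)%N by move=> /eqP <-; apply: leq_addl.
case: (ex_maxnP exQ Qb) => l /eqP Ql lmax.
have [lm|ml] := ltnP l (m i j); last first.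
  (* an alternating word of length m can be peeled off: the braid relation shortens g s_i *)
  have := lu (m i j) (l - m i j)%N; rewrite subnKC // => lum.
  have := ell_mulr (Yu (m i j)) (Ya (m i j).-1).
  rewrite size_alt -alt_braid // mulmxA -gu => lgi.
  have := leq_trans gi lgi; have := m_offdiag ij; lia.
have nS : nonneg (u l *m v (x l.+1)).
  apply: (IH _ _ _ (Yu l) (xY _)); first by have := lmax _ Q1; lia.
  rewrite -uS; have : ~~ Q l.+1 by apply/negP => /lmax; rewrite ltnn.
  by rewrite /Q => /eqP; have := lg l.+1; lia.
have nP : nonneg (u l *m v (x l)).
  apply: (IH _ _ _ (Yu l) (xY _)); first by have := lmax _ Q1; lia.
  case: l Ql {lm nS} lmax => [|l] Ql lmax; first by have := lmax _ Q1.
  by rewrite -uP; have := lg l; lia.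
rewrite (gu l) -mulmxA; apply: alt_root_nonneg => //.
  by move: nS nP; rewrite /x /=; case: (odd l).
by move: nS nP; rewrite /x /=; case: (odd l).
Qed.

Lemma ell_lt_root_nonpos Y g i : parabolic Y g -> i \in Y ->
  (ell Y (g *m s i) < ell Y g)%N -> nonneg (- (g *m v i)).
Proof.
move=> Yg iY l; rewrite -mulmxN -refl_root mulmxA; apply: (@ell_root_nonneg Y) => //.
  by apply: paraM => //; apply: para_refl.
by rewrite -mulmxA refl_sq // mulmx1 ltnW.
Qed.

Lemma root_sign Y g i : parabolic Y g -> i \in Y ->
  nonneg (g *m v i) \/ nonneg (- (g *m v i)).
Proof.
move=> Yg iY; have [l|l] := leqP (ell Y g) (ell Y (g *m s i)).
  by left; apply: ell_root_nonneg l.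
by right; apply: ell_lt_root_nonpos l.
Qed.

(** Induction along a reduced word: every letter that is appended belongs to a root
    made nonnegative by the part already built. *)
Lemma para_ind Y (Q : 'M[R]_n -> Prop) : Q 1%:M ->
  (forall g i, parabolic Y g -> i \in Y -> nonneg (g *m v i) -> Q g -> Q (g *m s i)) ->
  forall g, parabolic Y g -> Q g.
Proof.
move=> Q1 QS g; have [k] := ubnP (ell Y g); elim: k => // k IH in g *.
rewrite ltnS => gk Yg; have [[r [rY ew sw]] _] := ellP Yg.
case: (lastP r) rY ew sw => [|r0 i] rY ew sw; first by rewrite -ew.
have iY : i \in Y by apply: rY; rewrite mem_rcons mem_head.
have r0Y : {subset r0 <= Y} by move=> l lw; apply: rY; rewrite mem_rcons inE lw orbT.
have Yw0 := para_wprod r0Y.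
have lw0 : (ell Y (wprod r0) < ell Y g)%N.
  by rewrite -sw size_rcons ltnS ell_word.
rewrite -ew wprod_rcons in lw0 gk *; apply: QS => //.
  by apply: (@ell_root_nonneg Y) => //; apply: ltnW.
by apply: IH => //; lia.
Qed.

(** Appending s_i to g lowers g y by 2 <v_i, y> g v_i, a nonnegative vector. *)
Lemma dominant_sub Y g y : (forall i, i \in Y -> 0 <= dot (v i) y) -> parabolic Y g ->
  nonneg (y - g *m y).
Proof.
move=> hy; elim/para_ind: g / => [|g i Yg iY gi IH].
  by rewrite mul1mx subrr; apply: nonneg0.
rewrite -mulmxA reflectionE mulmxBr -scalemxAr opprB addrCA addrC; apply: nonnegD => //.
by apply: nonnegZ => //; rewrite mulr_ge0 // hy.
Qed.

(** All the nonnegative decrements of [dominant_sub] must vanish when g y = y, and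
    the decrement of the letter i is 2 <v_i, y> times a nonzero root. *)
Lemma dominant_stab Y g y : (forall i, i \in Y -> 0 <= dot (v i) y) -> parabolic Y g ->
  g *m y = y -> parabolic [set i in Y | dot (v i) y == 0]%SET g.
Proof.
move=> hy; elim/para_ind: g / => [|g i Yg iY gi IH] gy; first exact: para1.
have e : y - g *m y = - ((2 * dot (v i) y) *: (g *m v i)).
  apply/eqP; rewrite -subr_eq0 opprK -{1}gy -mulmxA reflectionE mulmxBr -scalemxAr.
  by rewrite addrAC subrK subrr.
have z0 : (2 * dot (v i) y) *: (g *m v i) = 0.
  apply: nonneg_anti; first by apply: nonnegZ => //; rewrite mulr_ge0 // hy.
  by rewrite -e; apply: dominant_sub Yg.
have gi0 : g *m v i != 0.
  apply/eqP => gi0; have := dot_root i; rewrite -(para_dot _ _ Yg) gi0 dot0r.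
  by move/eqP; rewrite eq_sym oner_eq0.
have iy : dot (v i) y == 0.
  by move/eqP: z0; rewrite scaler_eq0 (negbTE gi0) orbF mulf_eq0 pnatr_eq0.
apply: paraM; last by apply: para_refl; rewrite inE iY.
by apply: IH; apply/eqP; rewrite eq_sym -subr_eq0 e z0 oppr0.
Qed.

(** * Dominant representatives *)

Hypothesis G_finite : finite_set (parabolic full).

(** A vector in the interior of the dominant cone: pairing with it detects the sign of a
    root. *)
Definition rho : 'cV[R]_n := \sum_j weight j.

Lemma dot_rho i : dot (v i) rho = 1.
Proof.
rewrite dot_sumr (bigD1 i) //= dot_weight eqxx big1 ?addr0 // => j ji.
by rewrite dot_weight eq_sym (negbTE ji).
Qed.

(** A point of the orbit that maximizes <rho, .> cannot be raised by any s_i. *)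
Lemma orbit_dominant Y y :
  exists2 g, parabolic Y g & forall i, i \in Y -> 0 <= dot (v i) (g *m y).
Proof.
have Yfin : finite_set (parabolic Y).
  by apply: sub_finite_set G_finite => g; apply: paraS; apply: finset.subsetT.
have [|g Yg gmax] := finite_argmax (fun g => dot rho (g *m y)) Yfin.
  by exists 1%:M; apply: para1.
exists g => // i iY; have := gmax _ (paraM (para_refl iY) Yg).
rewrite -mulmxA reflectionE dotBr dotZr (dotC rho (v i)) dot_rho mulr1.
by rewrite lerBlDr lerDl pmulr_rge0.
Qed.


(** * The faces of the orbit polytope *)

(** The orbit polytope is studied for an arbitrary dominant point x; only in the
    last part is the set of nodes that move x described by the decoration f. *)
Variable x : 'cV[R]_n.
Hypothesis x_dom : forall i, 0 <= dot (v i) x.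

Lemma root_dot_le0 i j : i != j -> dot (v i) (v j) <= 0.
Proof.
move=> /m_offdiag ij; have m0 : 0 < (m i j)%:R :> R by rewrite ltr0n; apply: leq_trans ij.
rewrite v_dot oppr_le0; apply: cos_ge0_pihalf; apply/andP; split.
  by apply: (@le_trans _ _ 0); rewrite ?oppr_le0 divr_ge0 ?pi_ge0.
by rewrite ler_pM2l ?pi_gt0 // lef_pV2 ?posrE // ler_nat.
Qed.

Lemma adj_dot i j : cox_adj m i j -> dot (v i) (v j) != 0.
Proof.
move=> /andP[_ ij]; rewrite v_dot oppr_eq0 gt_eqF // cos_gt0_pihalf //.
have m0 : 0 < (m i j)%:R :> R by rewrite ltr0n; apply: leq_trans ij.
apply/andP; split.
  by apply: (@lt_trans _ _ 0); rewrite ?oppr_lt0 divr_gt0 ?pi_gt0.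
by rewrite ltr_pM2l ?pi_gt0 // ltf_pV2 ?posrE // ltr_nat.
Qed.

Lemma nadj_dot i j : i != j -> ~~ cox_adj m i j -> dot (v i) (v j) = 0.
Proof.
move=> ij; rewrite /cox_adj ij -ltnNge => m3.
rewrite v_dot (_ : m i j = 2%N) ?cos_pihalf ?oppr0 //.
by have := m_offdiag ij; lia.
Qed.

Definition translate g (A : set 'cV[R]_n) := [set g *m y | y in A].

Lemma translate1 A : translate 1%:M A = A.
Proof.
apply/seteqP; split=> [_ [y Ay <-]|y Ay]; first by rewrite mul1mx.
by exists y; rewrite ?mul1mx.
Qed.

Lemma translateM g h A : translate (g *m h) A = translate g (translate h A).
Proof.
apply/seteqP; split=> [_ [y Ay <-]|_ [_ [y Ay <-] <-]].
  by exists (h *m y); rewrite ?mulmxA //; exists y.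
by exists y; rewrite ?mulmxA.
Qed.

Lemma translateS g A B : A `<=` B -> translate g A `<=` translate g B.
Proof. by move=> AB _ [y /AB By <-]; exists y. Qed.

Definition face J : set 'cV[R]_n := conv_hull [set g *m x | g in parabolic J].

Lemma face_x J : face J x.
Proof.
by apply: sub_conv_hull; exists 1%:M; rewrite ?mul1mx //; apply: para1.
Qed.

Lemma face_gx J g : parabolic J g -> face J (g *m x).
Proof. by move=> Jg; apply: sub_conv_hull; exists g. Qed.

Lemma faceS J K : J \subset K -> face J `<=` face K.
Proof. by move=> JK; apply: conv_hullS => _ [g /(paraS JK) Kg <-]; exists g. Qed.

(** If the larger group G_L has the same orbit of x as G_J, it stabilizes F_J. *)
Lemma face_stab J L g : J \subset L ->
  (forall h, parabolic L h -> exists2 h', parabolic J h' & h *m x = h' *m x) ->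
  parabolic L g -> translate g (face J) = face J.
Proof.
move=> JL LJ Lg; rewrite /translate -conv_hull_img; congr conv_hull.
apply/seteqP; split=> [_ [_ [h Jh <-] <-]|_ [h Jh <-]].
  have [h' Jh' e] := LJ _ (paraM Lg (paraS JL Jh)).
  by exists h' => //; rewrite -e mulmxA.
have [h' Jh' e] := LJ _ (paraM (paraV Lg) (paraS JL Jh)).
exists (h' *m x); first by exists h'.
by rewrite -e !mulmxA (para_trKr Lg) mul1mx.
Qed.

Lemma face_para J g : parabolic J g -> translate g (face J) = face J.
Proof. by apply: face_stab => // h Jh; exists h. Qed.

(** F_J lies in the translate by x of the span of the v_j, j in J. *)
Lemma face_weight J y j : face J y -> j \notin J -> dot y (weight j) = dot x (weight j).
Proof.
move=> /conv_sub_aff hy jJ; rewrite dotC; apply: dot_aff_eq hy => _ [g Jg <-].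
by rewrite dotC (para_dot_weight _ Jg).
Qed.

Lemma dominant_max c g : (forall i, 0 <= dot (v i) c) -> parabolic full g ->
  dot c (g *m x) <= dot c x.
Proof.
move=> c_dom Gg; rewrite -subr_ge0 -dotBr dotC; apply: nonneg_dot => //.
by apply: (dominant_sub _ Gg).
Qed.

(** Move g x by G_J to a point y with <v_i, y> >= 0 on J, which does not change <c, y>.
    Then x - y is a nonnegative combination of the v_i on which c vanishes, so only nodes of
    J occur in it and <x - y, y> >= 0.  As x and y have the same norm, x = y. *)
Lemma dominant_argmax c g : (forall i, 0 <= dot (v i) c) -> parabolic full g ->
  dot c (g *m x) = dot c x ->
  exists2 h, parabolic [set i | dot (v i) c == 0]%SET h & g *m x = h *m x.
Proof.
move=> c_dom Gg cg; set J := [set i | _]%SET.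
have [h Jh hdom] := orbit_dominant J (g *m x).
have Gh := paraS (finset.subsetT J) Jh.
rewrite mulmxA in hdom; set y := _ *m x in hdom.
have hc : h *m c = c by apply: (para_fix Jh) => i; rewrite inE => /eqP.
have cy : dot c y = dot c x by rewrite /y -mulmxA -{1}hc (para_dot _ _ Gh).
have xy : nonneg (x - y).
  by apply: (dominant_sub _ (paraM Gh Gg)).
have yx : dot y y = dot x x by apply: (para_dot _ _ (paraM Gh Gg)).
have coord j : j \notin J -> dot (x - y) (weight j) = 0.
  have : \sum_j dot (x - y) (weight j) * dot (v j) c == 0.
    under eq_bigr do rewrite -dotZl.
    by rewrite -dot_suml -weight_decomp dotBl !(dotC _ c) cy subrr.
  rewrite psumr_eq0 => [/allP /(_ j (mem_index_enum _)) /=|k _]; last exact: mulr_ge0.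
  by rewrite mulf_eq0 inE => /orP[/eqP->//|->].
have d0 : 0 <= dot (x - y) y.
  rewrite (weight_decomp (x - y)) dot_suml; apply: sumr_ge0 => j _.
  rewrite dotZl; have [jJ|/coord ->] := boolP (j \in J); last by rewrite mul0r.
  by rewrite mulr_ge0 ?hdom.
have : dot (x - y) (x - y) <= 0.
  have -> : dot (x - y) (x - y) = - (2 * dot (x - y) y).
    by rewrite !dotBr !dotBl yx (dotC y x); ring.
  by rewrite oppr_le0 mulr_ge0.
move=> /dot_le0_eq0/eqP; rewrite subr_eq0 => /eqP xey.
exists h^T; first exact: paraV.
by rewrite [in RHS]xey /y !mulmxA (para_trK Jh) mul1mx.
Qed.

Lemma face_dominant c : (forall i, 0 <= dot (v i) c) ->
  face full `&` [set y | dot c y = dot c x] = face [set i | dot (v i) c == 0]%SET.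
Proof.
move=> c_dom; rewrite /face conv_hull_face; last first.
  by move=> _ [g Gg <-]; apply: dominant_max.
congr conv_hull; apply/seteqP; split=> [_ [[g Gg <-]] /= /(dominant_argmax c_dom Gg)[h Jh ->]|].
  by exists h.
move=> _ [h Jh <-]; split; first by exists h => //; apply: paraS Jh; apply: finset.subsetT.
have hc : h *m c = c by apply: (para_fix Jh) => i; rewrite inE => /eqP.
by rewrite /= -{1}hc (para_dot _ _ Jh).
Qed.

(** A dominant functional orthogonal to v_i exactly for i in J, so that each F_J is a face. *)
Definition normal_of J : 'cV[R]_n := \sum_(j | j \notin J) weight j.

Lemma dot_normal_of J i : dot (v i) (normal_of J) = (i \notin J)%:R.
Proof.
rewrite dot_sumr; have [iJ|iJ] := boolP (i \in J).
  rewrite big1 // => j jJ; rewrite dot_weight //; case: eqP => // ij.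
  by rewrite -ij iJ in jJ.
rewrite (bigD1 i) //= dot_weight // eqxx big1 ?addr0 // => j /andP[_ ji].
by rewrite dot_weight // eq_sym (negbTE ji).
Qed.

Lemma normal_of_dom J i : 0 <= dot (v i) (normal_of J).
Proof. by rewrite dot_normal_of ler0n. Qed.

Lemma normal_of_face J :
  face full `&` [set y | dot (normal_of J) y = dot (normal_of J) x] = face J.
Proof.
rewrite face_dominant; last exact: normal_of_dom.
congr face; apply/setP => i; rewrite inE dot_normal_of.
by case: (i \in J); rewrite /= ?eqxx ?oner_eq0.
Qed.

(** A functional c is made dominant by some g; the maximum over the polytope of the
    transported functional is attained at x. *)
Lemma nonempty_facesP F : nonempty_faces (face full) F <->
  exists g J, parabolic full g /\ F = translate g (face J).
Proof.
split=> [[[c [c0 [cP ->]]] [y0 [Py0 cy0]]]|[g [J [Gg ->]]]].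
  have [g Gg gdom] := orbit_dominant full c.
  have cg y : dot c y = dot (g *m c) (g *m y) by rewrite (para_dot _ _ Gg).
  have gP : translate g (face full) = face full by apply: face_para.
  have gdom' i : 0 <= dot (v i) (g *m c) by apply: gdom; rewrite finset.in_setT.
  have c0E : c0 = dot (g *m c) x.
    apply/eqP; rewrite eq_le; apply/andP; split.
      rewrite -cy0 cg; apply: (@dot_conv_le _ _ [set h *m x | h in parabolic full]).
        by move=> _ [h Gh <-]; apply: dominant_max.
      by rewrite -/(face full) -gP; exists y0.
    have -> : x = g *m (g^T *m x) by rewrite mulmxA (para_trKr Gg) mul1mx.
    by rewrite -cg; apply: cP; apply/face_gx/paraV.
  exists g^T, [set i | dot (v i) (g *m c) == 0]%SET; split; first exact: paraV.
  rewrite -face_dominant // -c0E; apply/seteqP; split=> [y [Py cy]|_ [y [Py cy] <-]].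
    exists (g *m y); last by rewrite mulmxA (para_trK Gg) mul1mx.
    by split; [rewrite -gP; exists y | rewrite /= -cg].
  split; first by rewrite -(face_para (paraV Gg)); exists y.
  by rewrite /= cg mulmxA (para_trKr Gg) mul1mx.
split; last by exists (g *m x), x => //; apply: face_x.
exists (g *m normal_of J), (dot (normal_of J) x); split=> [y|].
  rewrite -{1}(face_para Gg) => -[z Pz <-]; rewrite (para_dot _ _ Gg).
  apply: dot_conv_le Pz => _ [h Gh <-]; apply: dominant_max => // i.
  exact: normal_of_dom.
rewrite -normal_of_face -[X in _ = X `&` _](face_para Gg).
apply/seteqP; split=> [_ [y [Py cy] <-]|_ [[y Py <-] cy]].
  by split; [exists y | rewrite /= (para_dot _ _ Gg)].
by exists y => //; split=> //; rewrite /= -cy /= (para_dot _ _ Gg).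
Qed.

(** * Sets of nodes reached by the rule *)

(** For i outside J, this says that i has value 1 when J is the set of nodes of value 2. *)
Definition touched J i := (dot (v i) x != 0) || [exists j in J, cox_adj m i j].

Inductive reachable : {set 'I_n} -> Prop :=
| reachable0 : reachable finset.set0
| reachableU J w of reachable J & w \notin J & touched J w : reachable (w |: J).

(** The nodes of value 0 or 2: the generators of G(f'). *)
Definition stab_nodes J := [set i | (i \in J) || ~~ touched J i]%SET.

Lemma sub_stab_nodes J : J \subset stab_nodes J.
Proof. by apply/fintype.subsetP => i; rewrite inE => ->. Qed.

(** A node outside J that is not touched by J fixes x and commutes with G_J, so appending
    its reflection to a word does not leave the orbit G_J x. *)
Lemma untouched_orbit J L : (forall i, i \in L -> i \notin J -> ~~ touched J i) ->
  forall g, parabolic L g -> exists2 h, parabolic J h & g *m x = h *m x.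
Proof.
move=> LJ _ [w /= wL <-]; elim: w wL => [|i w IH] wL.
  by exists 1%:M => //; apply: para1.
have [h Jh e] := IH (fun j jw => wL j (@mem_behead _ (i :: w) _ jw)).
have iL : i \in L by apply: wL; rewrite mem_head.
rewrite /= -mulmxA e; have [iJ|iJ] := boolP (i \in J).
  by exists (s i *m h); rewrite ?mulmxA //; apply: paraM => //; apply: para_refl.
exists h => //; have := LJ i iL iJ; rewrite negb_or negbK => /andP[/eqP ix].
rewrite negb_exists => /forallP nadj.
rewrite reflectionE -[v i in X in _ - X](_ : h *m v i = v i).
  by rewrite dotC (para_dot _ _ Jh) dotC ix mulr0 scale0r subr0.
apply: (para_fix Jh) => j jJ; rewrite dotC; apply: nadj_dot.
  by apply: contraNneq iJ => ->.
by have := nadj j; rewrite jJ.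
Qed.

Lemma face_stab_nodes J g : parabolic (stab_nodes J) g -> translate g (face J) = face J.
Proof.
apply: face_stab; first exact: sub_stab_nodes.
by apply: untouched_orbit => i; rewrite inE => /orP[->|].
Qed.

(** A reachable subset of J that cannot be enlarged inside J leaves only untouched nodes. *)
Lemma reachable_core J : exists K, [/\ reachable K, K \subset J & face J = face K].
Proof.
suff [K [gK KJ nt]] : exists K, [/\ reachable K, K \subset J &
    forall i, i \in J -> i \notin K -> ~~ touched K i].
  exists K; split=> //; apply/seteqP; split; last exact: faceS.
  by apply: conv_hullS => _ [g /(untouched_orbit nt)[h Kh ->] <-]; exists h.
have : exists K, reachable K /\ K \subset J.
  by exists finset.set0; split; [exact: reachable0 | exact: finset.sub0set].
case=> K; have [k] := ubnP #|J :\: K|; elim: k K => // k IH K; rewrite ltnS => kK [gK KJ].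
have [/existsP[i /and3P[iJ iK ti]]|none] :=
    boolP [exists i, [&& i \in J, i \notin K & touched K i]].
  apply: (IH (i |: K)); last first.
    by split; [exact: reachableU | rewrite finset.subUset KJ finset.sub1set iJ].
  apply: leq_trans kK; apply: proper_card; apply/properP; split.
    by apply: finset.setDS; apply: finset.subsetUr.
  by exists i; rewrite !inE ?eqxx ?iJ ?iK.
exists K; split=> // i iJ iK; apply/negP => ti; move/negP: none; apply.
by apply/existsP; exists i; rewrite iJ iK.
Qed.

(** If w moves x, the difference of x and s_w x is a multiple of v_w.  If w is adjacent to
    j and v_j is already a direction, so is s_w v_j, and s_w v_j - v_j is a nonzero multiple
    of v_w. *)
Lemma reachable_root_dir J j : reachable J -> j \in J -> aff_hull (face J) (x + v j).
Proof.
move=> gJ; elim: gJ j => [|{}J w gJ IH wJ tw] j; first by rewrite inE.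
have affS y : aff_hull (face J) y -> aff_hull (face (w |: J)) y.
  move=> [k [a [z [a1 Az ->]]]]; exists k, a, z; split=> // i.
  by apply: (faceS (finset.subsetUr _ _)).
rewrite in_setU1 => /orP[/eqP ->{j}|/IH/affS //].
have hx : aff_hull (face (w |: J)) x by apply/sub_aff_hull/face_x.
have sw : parabolic (w |: J) (s w) by apply: para_refl; rewrite setU11.
have hsx : aff_hull (face (w |: J)) (s w *m x) by apply/sub_aff_hull/face_gx.
case/orP: tw => [x0|/exists_inP[j jJ /adj_dot wj]].
  have := aff_hull_shift (2 * dot (v w) x)^-1 hx hx hsx; congr aff_hull.
  rewrite reflectionE opprB addrCA subrr addr0 scalerA mulVf ?scale1r //.
  by rewrite mulf_neq0 // pnatr_eq0.
have hj := affS _ (IH _ jJ).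
have hsj : aff_hull (face (w |: J)) (s w *m (x + v j)).
  by rewrite -(face_para sw); apply: aff_hull_img; exists (x + v j).
have := aff_hull_shift (2 * dot (v w) (v j))^-1
  (aff_hull_shift (2 * dot (v w) (v j))^-1 hx hj hsj) hsx hx.
congr aff_hull; rewrite !reflectionE dotDr.
apply/matrixP => a b; rewrite !mxE; field.
by rewrite wj.
Qed.

Lemma reachable_span J (b : 'I_n -> R) : reachable J ->
  aff_hull (face J) (x + \sum_(j in J) b j *: v j).
Proof.
move=> gJ; elim/big_rec: _ => [|j y jJ hy]; first by rewrite addr0; apply/sub_aff_hull/face_x.
have hx : aff_hull (face J) x by apply/sub_aff_hull/face_x.
have := aff_hull_shift (b j) hy (reachable_root_dir gJ jJ) hx.
by rewrite (addrC x (v j)) addrK -addrA (addrC y).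
Qed.

(** Vanishing coordinates are all that is needed to describe the span of some of the g v_j. *)
Lemma span_weight g (r : seq 'I_n) u k : parabolic full g -> k \notin r ->
  u \in <<[seq g *m v j | j <- r]>>%VS -> dot (g^T *m u) (weight k) = 0.
Proof.
move=> Gg kr /(@coord_span _ _ _ (in_tuple _)) ->.
rewrite mulmx_sumr dot_suml big1 // => i _; rewrite -scalemxAr dotZl.
have : (in_tuple [seq g *m v j | j <- r])`_i \in [seq g *m v j | j <- r].
  by rewrite mem_nth.
case/mapP => j jr ->; rewrite mulmxA (para_trK Gg) mul1mx dot_weight //.
case: eqP => [jk|]; last by rewrite mulr0.
by rewrite -jk jr in kr.
Qed.

Lemma span_free g (r : seq 'I_n) : parabolic full g -> uniq r ->
  free [seq g *m v j | j <- r].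
Proof.
move=> Gg; elim: r => [|k r IH] /=; first by rewrite nil_free.
case/andP => kr /IH fr; rewrite free_cons fr andbT; apply/negP => /(span_weight Gg kr).
rewrite mulmxA (para_trK Gg) mul1mx dot_weight // eqxx => /eqP.
by rewrite oner_eq0.
Qed.

Lemma has_aff_dim_uniq (A : set 'cV[R]_n) k l : has_aff_dim A k -> has_aff_dim A l -> k = l.
Proof.
suff sub (p q : 'cV[R]_n) (U V : {vspace 'cV[R]_n}) :
    [set p + u | u in [set u | u \in U]] = [set q + u | u in [set u | u \in V]] ->
    (U <= V)%VS.
  move=> [p [U [hU <-]]] [q [V [hV <-]]]; rewrite hU in hV.
  by apply/eqP; rewrite eqn_leq !dimvS // (sub _ _ _ _ hV, sub _ _ _ _ (esym hV)).
move=> e; apply/subvP => u uU.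
have [u0 /= u0V e0] : [set q + u | u in [set u | u \in V]] p.
  by rewrite -e; exists 0; rewrite ?addr0 //= mem0v.
have [u1 /= u1V e1] : [set q + u | u in [set u | u \in V]] (p + u).
  by rewrite -e; exists u.
have -> : u = u1 - u0.
  apply: (addrI p); rewrite -e1 -e0.
  by apply/matrixP => a b; rewrite !mxE; ring.
exact: rpredB.
Qed.

Lemma face_dim g J k : reachable J -> parabolic full g ->
  has_aff_dim (translate g (face J)) k <-> k = #|J|.
Proof.
move=> gJ Gg; suff hd : has_aff_dim (translate g (face J)) #|J|.
  by split=> [/has_aff_dim_uniq/(_ hd)|->].
exists (g *m x), <<[seq g *m v j | j <- enum J]>>%VS; split; last first.
  by rewrite (eqnP (span_free Gg (enum_uniq J))) size_map cardE.
apply/seteqP; split=> [y hy|_ [u /= uU <-]].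
  have hy' : aff_hull (face J) (g^T *m y).
    have : aff_hull (translate g^T (translate g (face J))) (g^T *m y).
      by apply: aff_hull_img; exists y.
    by rewrite -translateM (para_trK Gg) translate1.
  exists (y - g *m x); last by rewrite addrC subrK.
  have -> : y - g *m x = \sum_(j in J) dot (g^T *m y - x) (weight j) *: (g *m v j).
    have -> : y - g *m x = g *m (g^T *m y - x).
      by rewrite mulmxBr mulmxA (para_trKr Gg) mul1mx.
    rewrite {1}(weight_decomp (g^T *m y - x)) mulmx_sumr [RHS]big_mkcond /=.
    apply: eq_bigr => j _; rewrite -scalemxAr; case: ifPn => // jJ.
    rewrite dotBl dotC (_ : dot _ _ = dot x (weight j)) ?subrr ?scale0r //.
    by apply: dot_aff_eq hy' => z Jz; rewrite dotC (face_weight Jz).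
  apply: rpred_sum => j jJ; apply: rpredZ; apply: memv_span; apply/mapP; exists j => //.
  by rewrite mem_enum.
have -> : g *m x + u = g *m (x + \sum_(j in J) dot (g^T *m u) (weight j) *: v j).
  rewrite mulmxDr; congr (_ + _).
  transitivity (g *m (g^T *m u)); first by rewrite mulmxA (para_trKr Gg) mul1mx.
  congr (_ *m _); rewrite {1}(weight_decomp (g^T *m u)) [RHS]big_mkcond /=.
  apply: eq_bigr => j _; case: ifPn => // jJ.
  by rewrite (span_weight Gg _ uU) ?scale0r // mem_enum.
by apply: aff_hull_img; eexists; last by []; apply: reachable_span.
Qed.

(** * Inclusion of faces *)

(** The functional <g ., weight i> is constant on F_J, hence on its affine hull, which contains
    both x and x + v_j. *)
Lemma face_sub_root J K g j i : reachable J -> j \in J -> translate g (face J) `<=` face K ->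
  i \notin K -> dot (g *m v j) (weight i) = 0.
Proof.
move=> gJ jJ gJK iK; have c z : dot (g *m z) (weight i) = dot (g^T *m weight i) z.
  by rewrite dot_mulmx dotC.
have h z : face J z -> dot (g^T *m weight i) z = dot x (weight i).
  by move=> Jz; rewrite -c; apply: face_weight iK; apply: gJK; exists z.
have := dot_aff_eq h (reachable_root_dir gJ jJ).
by rewrite dotDr (h _ (face_x J)) c => /eqP; rewrite -subr_eq0 addrC addKr => /eqP.
Qed.

(** Write g v_j = sum of a_k v_k with a_k >= 0.  Then v_j is the nonnegative combination
    with the same coefficients of the nonnegative vectors g^-1 v_k; as v_j spans an extreme
    ray of the cone, each g^-1 v_k with a_k > 0 is a multiple of v_j, and it is a unit
    vector. *)
Lemma simple_image K g j : parabolic full g -> nonneg (g *m v j) ->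
  (forall i, i \notin K -> dot (g *m v j) (weight i) = 0) ->
  (forall k, k \in K -> nonneg (g^T *m v k)) ->
  exists2 k, k \in K & g *m v j = v k.
Proof.
move=> Gg gj0 gjK hK; set a := fun k => dot (g *m v j) (weight k).
have vj : v j = \sum_k a k *: (g^T *m v k).
  rewrite -[LHS]mul1mx -(para_trK Gg) -mulmxA {1}(weight_decomp (g *m v j)) mulmx_sumr.
  by apply: eq_bigr => k _; rewrite -scalemxAr.
have [k ak] : exists k, a k != 0.
  apply/existsP; rewrite -negb_forall; apply/negP => /forallP a0.
  have := dot_root j; rewrite {1}vj big1 => [|k _].
    by rewrite dotC dot0r => /eqP; rewrite eq_sym oner_eq0.
  by rewrite (eqP (a0 k)) scale0r.
have kK : k \in K by apply: contraNT ak; rewrite /a => /gjK ->.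
exists k => //; set b := dot (g^T *m v k) (weight j).
have gk : g^T *m v k = b *: v j.
  apply: weight_inj => l; rewrite dotZl dot_weight; case: eqP => [<-|/eqP jl].
    by rewrite mulr1.
  have : \sum_i a i * dot (g^T *m v i) (weight l) == 0.
    under eq_bigr do rewrite -dotZl.
    by rewrite -dot_suml -vj dot_weight (negbTE jl).
  rewrite psumr_eq0 => [/allP /(_ k (mem_index_enum _)) /=|i _].
    by rewrite mulf_eq0 (negbTE ak) /= mulr0 => /eqP.
  have [iK|/gjK ai] := boolP (i \in K); first by rewrite mulr_ge0 ?gj0 ?hK.
  by rewrite /a ai mul0r.
have b0 : 0 <= b by apply: hK.
have : dot (g^T *m v k) (g^T *m v k) = 1 by rewrite (para_dot _ _ (paraV Gg)) dot_root.
rewrite gk dotZl dotZr dot_root mulr1 -expr2 => /eqP; rewrite sqrp_eq1 // => /eqP b1.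
by rewrite -[v j]scale1r -b1 -gk mulmxA (para_trKr Gg) mul1mx.
Qed.

(** The nodes of value 0.  For J empty these are the nodes fixing x. *)
Definition aloof J := [set i | (i \notin J) && ~~ touched J i]%SET.

Lemma aloof_stab_nodes J : aloof J \subset stab_nodes J.
Proof. by apply/fintype.subsetP => i; rewrite !inE => /andP[_ ->]; rewrite orbT. Qed.

(** Induction along the construction of J, the group containing g shrinking at each step.
    When g lies in the parabolic subgroup of the nodes aloof from J and w is the next node, w is
    not one of them, so the coordinate of g v_w along v_w is 1; being a simple root, g v_w is v_w.
    Now -v_w is dominant for the aloof nodes, so g is generated by those orthogonal to
    v_w, which are aloof from J and w. *)
Lemma simple_rigid J K g : reachable J ->
  parabolic (aloof finset.set0) g ->
  (forall j, j \in J -> exists2 k, k \in K & g *m v j = v k) ->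
  J \subset K /\ parabolic (aloof J) g.
Proof.
elim=> [|{}J w gJ IH wJ tw] Zg hg; first by split=> //; apply: finset.sub0set.
have [JK Yg] := IH Zg (fun j jJ => hg j (finset.setU1r _ jJ)).
have wY : w \notin aloof J by rewrite inE wJ negbK.
have [k kK gw] := hg w (setU11 _ _).
have kw : k = w.
  have := para_dot_weight (v w) Yg wY; rewrite gw !dot_weight eqxx.
  by case: eqP => // _ /eqP; rewrite eq_sym oner_eq0.
rewrite kw in kK gw; split; first by rewrite finset.subUset finset.sub1set kK.
have iw i : i \in aloof J -> i != w by move=> iY; apply: contraNneq wY => <-.
have dom i : i \in aloof J -> 0 <= dot (v i) (- v w).
  by move=> /iw/root_dot_le0; rewrite dotNr oppr_ge0.
apply: paraS (dominant_stab dom Yg _); last by rewrite mulmxN gw.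
apply/fintype.subsetP => i; rewrite inE => /andP[iY]; rewrite dotNr oppr_eq0 => iw0.
have := iY; rewrite !inE => /andP[iJ]; rewrite !negb_or (iw _ iY) iJ => /andP[-> /=].
move=> nadj; rewrite negb_exists; apply/forallP => j; rewrite !inE.
apply/negP => /andP[/orP[/eqP->|jJ] ij]; first by rewrite (negbTE (adj_dot ij)) in iw0.
by move/negP: nadj; apply; apply/existsP; exists j; rewrite jJ.
Qed.

(** G_Y does not change the coordinate along v_i, which is 1. *)
Lemma root_pos Y g i : parabolic Y g -> i \notin Y -> nonneg (g *m v i).
Proof.
move=> Yg iY; have Gg := paraS (finset.subsetT Y) Yg.
have [//|/(_ i)] := root_sign Gg (finset.in_setT i).
rewrite dotNl (para_dot_weight _ Yg iY) dot_weight eqxx => h.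
by have : (0 : R) < 1 by []; rewrite ltNge -oppr_ge0 h.
Qed.

(** The maximum of <rho, g rho> over the double coset cannot be increased by a
    reflection from either side. *)
Lemma double_coset_min Y (A B : {set 'I_n}) (z : 'M[R]_n) :
  A \subset Y -> B \subset Y -> parabolic Y z ->
  exists a b, [/\ parabolic A a, parabolic B b,
    forall i, i \in A -> nonneg ((a *m z *m b)^T *m v i) &
    forall j, j \in B -> nonneg (a *m z *m b *m v j)].
Proof.
move=> AY BY Yz.
pose D := [set g | exists a b, [/\ parabolic A a, parabolic B b & g = a *m z *m b]].
have DY g : D g -> parabolic Y g.
  by move=> [a [b [Aa Bb ->]]]; apply: paraM (paraS BY Bb); apply: paraM (paraS AY Aa) _.
have Dfin : finite_set D.
  by apply: sub_finite_set G_finite => g /DY; apply: paraS; apply: finset.subsetT.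
have Dz : D !=set0.
  by exists z, 1%:M, 1%:M; rewrite mul1mx mulmx1; split=> //; apply: para1.
have [_ [a [b [Aa Bb ->]]] gmax] := finite_argmax (fun g => dot rho (g *m rho)) Dfin Dz.
have Yg : parabolic Y (a *m z *m b) by apply: DY; exists a, b.
have pos g i : parabolic Y g -> i \in Y -> 0 <= dot rho (g *m v i) -> nonneg (g *m v i).
  move=> Yg' iY h; have [//|hN] := root_sign Yg' iY.
  rewrite (_ : g *m v i = 0); first exact: nonneg0.
  have hs : dot (- (g *m v i)) rho = \sum_j dot (- (g *m v i)) (weight j).
    by rewrite dot_sumr.
  have h0 : \sum_j dot (- (g *m v i)) (weight j) == 0.
    rewrite eq_le sumr_ge0 ?andbT => [|j _]; last exact: hN.
    by rewrite -hs dotNl oppr_le0 dotC.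
  apply: weight_inj => j; rewrite [RHS]dotC dot0r; apply/eqP; rewrite -oppr_eq0 -dotNl.
  by move: h0; rewrite psumr_eq0 // => /allP; apply; apply: mem_index_enum.
exists a, b; split=> // [i iA|j jB].
  apply: (pos _ _ (paraV Yg)); first exact: (fintype.subsetP AY).
  have /gmax : D (s i *m (a *m z *m b)).
    by exists (s i *m a), b; rewrite !mulmxA; split=> //; apply: paraM => //; apply: para_refl.
  rewrite -(mulmxA (s i)) reflectionE dotBr dotZr (dotC rho (v i)) dot_rho mulr1.
  by rewrite -dot_mulmx (dotC (_ *m _) (v i)) lerBlDr lerDl pmulr_rge0.
apply: (pos _ _ Yg); first exact: (fintype.subsetP BY).
have /gmax : D (a *m z *m b *m s j).
  by exists a, (b *m s j); rewrite !mulmxA; split=> //; apply: paraM => //; apply: para_refl.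
rewrite -(mulmxA _ (s j)) reflectionE dot_rho mulr1 mulmxBr -scalemxAr dotBr dotZr.
by rewrite lerBlDr lerDl pmulr_rge0.
Qed.

(** The value at h^-1 g x of a functional exposing F_K shows that h^-1 g = k z with k in
    G_K and z x = x; [simple_rigid] is applied to the element a z b that
    [double_coset_min] finds in the double coset of z, and a, b are absorbed into the
    cosets of h and g. *)
Lemma face_subP g h J K : parabolic full g -> parabolic full h -> reachable J -> reachable K ->
  translate g (face J) `<=` translate h (face K) <->
  J \subset K /\
  left_coset g (parabolic (stab_nodes J)) `&` left_coset h (parabolic (stab_nodes K)) !=set0.
Proof.
move=> Gg Gh gJ gK; split=> [sub|[JK [_ [[a Ja <-] [b Kb e]]]]]; last first.
  rewrite -(face_stab_nodes Ja) -(face_stab_nodes Kb) -!translateM e.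
  by apply: translateS; apply: faceS.
have Gg1 := paraM (paraV Gh) Gg; set g1 := h^T *m g in Gg1.
have sub1 : translate g1 (face J) `<=` face K.
  rewrite translateM => y hy; rewrite -[face K]translate1 -(para_trK Gh) translateM.
  exact: translateS hy.
have [k Kk g1x] : exists2 k, parabolic K k & g1 *m x = k *m x.
  have := sub1 _ (ex_intro2 _ _ x (face_x J) erefl); rewrite -normal_of_face => -[_ /=].
  move=> /(dominant_argmax (normal_of_dom K) Gg1)[k Kk ->]; exists k => //.
  apply: paraS Kk; apply/fintype.subsetP => i.
  by rewrite inE dot_normal_of; case: (i \in K) => //=; rewrite oner_eq0.
have Gk := paraS (finset.subsetT K) Kk.
pose z := k^T *m g1; have Gz : parabolic full z by apply: paraM => //; apply: paraV.
have zx : z *m x = x by rewrite -mulmxA g1x mulmxA (para_trK Kk) mul1mx.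
have Zz : parabolic (aloof finset.set0) z.
  apply: paraS (dominant_stab _ Gz zx) => [|i _]; last exact: x_dom.
  apply/fintype.subsetP => i; rewrite !inE /= negb_or negbK => -> /=.
  by rewrite negb_exists; apply/forallP => j; rewrite inE.
pose A := (K :&: aloof finset.set0)%SET; pose B := (J :&: aloof finset.set0)%SET.
have [a [b [Aa Bb apos bpos]]] := double_coset_min
  (finset.subsetIr K (aloof finset.set0)) (finset.subsetIr J (aloof finset.set0)) Zz.
have Ka := paraS (finset.subsetIl _ _) Aa; have Jb := paraS (finset.subsetIl _ _) Bb.
set g' := a *m z *m b in apos bpos.
have Zg' : parabolic (aloof finset.set0) g'.
  apply: paraM (paraS (finset.subsetIr _ _) Bb).
  by apply: paraM (paraS (finset.subsetIr _ _) Aa) Zz.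
have Gg' := paraS (finset.subsetT _) Zg'.
have sub' : translate g' (face J) `<=` face K.
  rewrite translateM (face_para Jb) translateM -(face_para Ka); apply: translateS.
  rewrite translateM -(face_para (paraV Kk)); exact: translateS.
have Jpos j : j \in J -> nonneg (g' *m v j).
  move=> jJ; have [jZ|jZ] := boolP (j \in aloof finset.set0); last exact: root_pos jZ.
  by apply: bpos; rewrite inE jJ.
have Kpos i : i \in K -> nonneg (g'^T *m v i).
  move=> iK; have [iZ|iZ] := boolP (i \in aloof finset.set0).
    by apply: apos; rewrite inE iK.
  exact: root_pos (paraV Zg') iZ.
have [|JK Jg'] := simple_rigid gJ Zg' (K := K).
  move=> j jJ; apply: simple_image => //; first exact: Jpos.
  by move=> i; apply: face_sub_root sub'.
split=> //; exists (g *m (b *m g'^T)); split.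
  exists (b *m g'^T) => //; apply: paraM; first exact: paraS (sub_stab_nodes J) Jb.
  by apply: paraV; apply: paraS (aloof_stab_nodes J) Jg'.
exists (k *m a^T); first by apply: paraS (sub_stab_nodes K) (paraM Kk (paraV Ka)).
rewrite /g' /z /g1 !trmx_mul !trmxK !mulmxA.
have -> : g *m b *m b^T = g by rewrite -mulmxA (para_trKr Jb) mulmx1.
by rewrite (para_trKr Gg) mul1mx.
Qed.

Lemma face_eqP g h J K : parabolic full g -> parabolic full h -> reachable J -> reachable K ->
  translate g (face J) = translate h (face K) <->
  J = K /\ left_coset g (parabolic (stab_nodes J)) = left_coset h (parabolic (stab_nodes K)).
Proof.
have cosetE g' h' u L : parabolic (stab_nodes L) u -> h' = g' *m u ->
    left_coset h' (parabolic (stab_nodes L)) = left_coset g' (parabolic (stab_nodes L)).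
  move=> Lu ->; apply/seteqP; split=> _ [w Lw <-].
    by exists (u *m w); rewrite ?mulmxA //; apply: paraM.
  exists (u^T *m w); first by apply: paraM => //; apply: paraV.
  by rewrite mulmxA -(mulmxA g') (para_trKr Lu) mulmx1.
move=> Gg Gh gJ gK; split=> [e|[eJ e]].
  have s1 : translate g (face J) `<=` translate h (face K) by rewrite e.
  have s2 : translate h (face K) `<=` translate g (face J) by rewrite e.
  have [JK [_ [[a Ja <-] [b Kb eb]]]] := (face_subP Gg Gh gJ gK).1 s1.
  have [KJ _] := (face_subP Gh Gg gK gJ).1 s2.
  have eJ : J = K by apply/eqP; rewrite finset.eqEsubset JK.
  rewrite -eJ in Kb *; split=> //.
  by rewrite -(cosetE g _ _ _ Ja erefl) -eb (cosetE h _ _ _ Kb erefl).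
have : left_coset h (parabolic (stab_nodes K)) h.
  by exists 1%:M; rewrite ?mulmx1 //; apply: para1.
by rewrite -e -eJ => -[a Ja <-]; rewrite translateM (face_stab_nodes Ja).
Qed.

(** * Decorations and pairs *)

Variable f : decoration n 'I_2.
Hypothesis f_x : forall i, (dot (v i) x != 0) = (f i == 1%N :> nat).

Lemma touchedS J K i : J \subset K -> touched J i -> touched K i.
Proof.
move=> /fintype.subsetP JK; rewrite /touched => /orP[->//|/exists_inP[j jJ ij]].
by apply/orP; right; apply/exists_inP; exists j => //; apply: JK.
Qed.

Lemma touchedU J w i : touched (w |: J) i = touched J i || cox_adj m i w.
Proof.
rewrite /touched -orbA; congr (_ || _); apply/exists_inP/orP.
  move=> [j]; rewrite in_setU1 => /orP[/eqP->|jJ] ij; [by right|left].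
  by apply/exists_inP; exists j.
case=> [/exists_inP[j jJ ij]|iw]; first by exists j; rewrite // in_setU1 jJ orbT.
by exists w => //; rewrite setU11.
Qed.

(** The first node in the construction of K that is missing from J is touched by the
    nodes before it, which lie in J. *)
Lemma reachable_next J K : reachable K -> ~~ (K \subset J) ->
  exists w, [/\ w \in K, w \notin J & touched J w].
Proof.
elim=> [|{}K w gK IH wK tw] nKJ; first by rewrite finset.sub0set in nKJ.
have [KJ|/IH[i [iK iJ ti]]] := boolP (K \subset J).
  exists w; rewrite setU11; split=> //; last exact: touchedS tw.
  by apply: contra nKJ => wJ; rewrite finset.subUset finset.sub1set wJ.
by exists i; rewrite in_setU1 iK orbT.
Qed.

(** The decoration that the rule produces from f when applied to the nodes of J, in any
    order. *)
Definition deco J : decoration n 'I_3 :=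
  [ffun i => if i \in J then inord 2 else if touched J i then inord 1 else inord 0].

Lemma deco_nat J i : deco J i = (if i \in J then 2 else touched J i)%N :> nat.
Proof. by rewrite ffunE; case: ifP => // _; [|case: ifP => // _]; rewrite inordK. Qed.

Lemma deco1 J i : deco J i = 1%N :> nat <-> i \notin J /\ touched J i.
Proof. by rewrite deco_nat; case: (i \in J); case: (touched J i); split=> // -[]. Qed.

Lemma deco_inj : injective deco.
Proof.
move=> J K e; apply/setP => i; have := deco_nat J i; rewrite e deco_nat.
by case: (i \in J); case: (i \in K) => //; case: (touched _ i).
Qed.

Lemma deco_set0 : deco finset.set0 = deco_lift f.
Proof.
apply/ffunP => i; apply: val_inj; rewrite /= deco_nat inE ffunE /=.
rewrite /touched f_x (_ : [exists _ in _, _] = false) ?orbF; last first.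
  by apply/existsP => -[j]; rewrite inE.
by case: (f i) => -[|[|]].
Qed.

Lemma star_deco J w : w \notin J -> touched J w -> star_on m (deco J) w = deco (w |: J).
Proof.
move=> wJ tw; apply/ffunP => i; rewrite [LHS]ffunE deco_nat [RHS]ffunE in_setU1 touchedU.
have [->|iw] := eqVneq i w; first by rewrite orbT.
rewrite orbF /=; have [//|iJ] := boolP (i \in J).
by case: (touched J i); case: (cox_adj m i w).
Qed.

Lemma star_step_deco J (h : decoration n 'I_3) : star_step m (deco J) h <->
  exists w, [/\ w \notin J, touched J w & h = deco (w |: J)].
Proof.
split=> [[w [/deco1[wJ tw] ->]]|[w [wJ tw ->]]]; exists w; first by rewrite star_deco.
by rewrite star_deco // deco1.
Qed.

Lemma star_iterP k (h : decoration n 'I_3) : star_iter m k (deco_lift f) h <->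
  exists J, [/\ reachable J, #|J| = k & h = deco J].
Proof.
split=> [|[J [gJ <- ->]]]; last first.
  elim: gJ => [|{}J w gJ IH wJ tw]; first by rewrite cards0 deco_set0.
  rewrite cardsU1 wJ; exists (deco J); split=> //; apply/star_step_deco.
  by exists w.
elim: k h => [h ->|k IH h [_ [/IH[J [gJ Jk ->]] /star_step_deco[w [wJ tw ->]]]]].
  by exists finset.set0; rewrite cards0 deco_set0; split=> //; apply: reachable0.
by exists (w |: J); rewrite cardsU1 wJ Jk; split=> //; apply: reachableU.
Qed.

Lemma full_group : refl_group v setT = parabolic full.
Proof. by apply: refl_groupE => i; split=> // _; rewrite finset.in_setT. Qed.

Lemma deco_groupE J : deco_group v (deco J) = parabolic (stab_nodes J).
Proof.
apply: refl_groupE => i; rewrite inE /= deco1; case: (i \in J); case: (touched J i) => /=.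
all: by split=> // h; case: h || case.
Qed.

Definition wpair_of g J : wpair R n := (left_coset g (parabolic (stab_nodes J)), deco J).

Lemma wpairs_of_rankP k p : wpairs_of_rank v m f k p <->
  exists g J, [/\ parabolic full g, reachable J, #|J| = k & p = wpair_of g J].
Proof.
rewrite /wpairs_of_rank full_group /=; case: p => H h /=; split.
  move=> [/star_iterP[J [gJ Jk ->]] [g Gg ->]]; exists g, J; split=> //.
  by rewrite deco_groupE.
move=> [g [J [Gg gJ Jk [-> ->]]]]; split; first by apply/star_iterP; exists J.
by exists g; rewrite ?deco_groupE.
Qed.

Lemma wpairsP p : wpairs v m f p <->
  exists g J, [/\ parabolic full g, reachable J & p = wpair_of g J].
Proof.
split=> [[k _ /wpairs_of_rankP[g [J [Gg gJ _ ->]]]]|[g [J [Gg gJ ->]]]].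
  by exists g, J.
exists #|J|; first by rewrite -[leqRHS]card_ord max_card.
by apply/wpairs_of_rankP; exists g, J.
Qed.

Lemma wpair_of_eq g h J K : parabolic full g -> parabolic full h -> reachable J -> reachable K ->
  wpair_of g J = wpair_of h K <-> translate g (face J) = translate h (face K).
Proof.
move=> Gg Gh gJ gK; rewrite face_eqP //; split=> [[e /deco_inj]|[eJ e]] //.
by rewrite /wpair_of e eJ.
Qed.

Lemma wpair_coverP g h J K : parabolic full g -> parabolic full h -> reachable J -> reachable K ->
  wpair_cover v m f (wpair_of g J) (wpair_of h K) <->
  (exists w, [/\ w \notin J, touched J w & K = w |: J]) /\
  left_coset g (parabolic (stab_nodes J)) `&` left_coset h (parabolic (stab_nodes K)) !=set0.
Proof.
move=> Gg Gh gJ gK; split=> [[k [_ _ /star_step_deco[w [wJ tw /deco_inj e]] meet]]|].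
  by split=> //; exists w.
move=> [[w [wJ tw e]] meet]; exists #|J|; split=> //.
- by apply/wpairs_of_rankP; exists g, J.
- by apply/wpairs_of_rankP; exists h, K; rewrite e cardsU1 wJ in gK *.
- by apply/star_step_deco; exists w; rewrite -e.
Qed.

(** The inverse of the labelling, which makes the implication from the order of pairs
    to inclusion an induction on the transitive closure. *)
Definition wpair_face (p : wpair R n) : set 'cV[R]_n :=
  [set y | exists g J, [/\ parabolic full g, reachable J, p = wpair_of g J &
                           translate g (face J) y]].

Lemma wpair_faceE g J : parabolic full g -> reachable J ->
  wpair_face (wpair_of g J) = translate g (face J).
Proof.
move=> Gg gJ; apply/seteqP; split=> [y [h [K [Gh gK e hy]]]|y hy]; last by exists g, J.
by rewrite ((wpair_of_eq Gg Gh gJ gK).1 e).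
Qed.

Lemma wpair_coset g u J : parabolic full g -> reachable J -> parabolic (stab_nodes J) u ->
  wpair_of (g *m u) J = wpair_of g J.
Proof.
move=> Gg gJ Ju; apply/wpair_of_eq => //; last by rewrite translateM face_stab_nodes.
by apply: paraM => //; apply: paraS Ju; apply: finset.subsetT.
Qed.

(** Add the nodes of K missing from J one at a time, keeping the representative g. *)
Lemma wpair_le_common g J K : parabolic full g -> reachable J -> reachable K -> J \subset K ->
  wpair_le v m f (wpair_of g J) (wpair_of g K).
Proof.
move=> Gg gJ gK; have [k] := ubnP #|K :\: J|; elim: k J gJ => // k IH J gJ.
rewrite ltnS => kJ JK; have [KJ|nKJ] := boolP (K \subset J).
  have -> : J = K by apply/eqP; rewrite finset.eqEsubset JK.
  exact: Relation_Operators.rt_refl.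
have [w [wK wJ tw]] := reachable_next gK nKJ; have gwJ := reachableU gJ wJ tw.
apply: (@Relation_Operators.rt_trans _ _ _ (wpair_of g (w |: J))).
  apply/Relation_Operators.rt_step/wpair_coverP => //; split; first by exists w.
  by exists g; split; exists 1%:M; rewrite ?mulmx1 //; apply: para1.
apply: IH => //; last by rewrite finset.subUset finset.sub1set wK.
apply: leq_trans kJ; apply: proper_card; apply/properP; split.
  by apply: finset.setDS; apply: finset.subsetUr.
by exists w; rewrite !inE ?eqxx ?wK ?wJ.
Qed.

Lemma wpair_leP g h J K : parabolic full g -> parabolic full h -> reachable J -> reachable K ->
  translate g (face J) `<=` translate h (face K) <->
  wpair_le v m f (wpair_of g J) (wpair_of h K).
Proof.
move=> Gg Gh gJ gK; split=> [/(face_subP Gg Gh gJ gK)[JK [_ [[a Ja <-] [b Kb e]]]]|le].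
  rewrite -(wpair_coset Gg gJ Ja) -(wpair_coset Gh gK Kb) e.
  apply: wpair_le_common => //; apply: paraM => //.
  by apply: paraS Ja; apply: finset.subsetT.
rewrite -(wpair_faceE Gg gJ) -(wpair_faceE Gh gK); elim: le.
- move=> p q [k [/wpairs_of_rankP[g1 [J1 [Gg1 gJ1 _ ->]]]]].
  move=> /wpairs_of_rankP[g2 [J2 [Gg2 gJ2 _ ->]]] /star_step_deco[w [_ _ /deco_inj e]] meet.
  rewrite !wpair_faceE //; apply/face_subP => //; split=> //.
  by rewrite e finset.subsetUr.
- by move=> p y.
- by move=> p q r _ pq _; apply: subset_trans.
Qed.

Lemma face_sub_eq g h J : parabolic full g -> parabolic full h -> reachable J ->
  translate g (face J) `<=` translate h (face J) -> translate g (face J) = translate h (face J).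
Proof.
move=> Gg Gh gJ /(face_subP Gg Gh gJ gJ)[_ [_ [[a Ja <-] [b Jb e]]]].
by rewrite -{1}(face_stab_nodes Ja) -translateM -e translateM (face_stab_nodes Jb).
Qed.

Lemma reachable_facesP F : nonempty_faces (face full) F <->
  exists g J, [/\ parabolic full g, reachable J & F = translate g (face J)].
Proof.
rewrite nonempty_facesP; split=> [[g [J [Gg ->]]]|[g [J [Gg _ ->]]]]; last by exists g, J.
by have [K [gK _ ->]] := reachable_core J; exists g, K.
Qed.

(** A cover adds exactly one node, since the face of the next node lies in between; conversely no
    set lies strictly between J and J with one more node. *)
Lemma order_coverP g h J K : parabolic full g -> parabolic full h -> reachable J -> reachable K ->
  order_cover (nonempty_faces (face full)) subset (translate g (face J)) (translate h (face K))
  <-> wpair_cover v m f (wpair_of g J) (wpair_of h K).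
Proof.
move=> Gg Gh gJ gK; rewrite wpair_coverP //; split.
  move=> [_ _ /(face_subP Gg Gh gJ gK)[JK meet] ne cov]; split=> //.
  case: meet => _ [[a Ja <-] [b Kb e]].
  have eg : translate g (face J) = translate (g *m a) (face J).
    by rewrite translateM (face_stab_nodes Ja).
  have eh : translate h (face K) = translate (g *m a) (face K).
    by rewrite -e translateM (face_stab_nodes Kb).
  have [KJ|/(reachable_next gK)[w [wK wJ tw]]] := boolP (K \subset J).
    case: ne; rewrite eg eh; congr (translate _ (face _)).
    by apply/eqP; rewrite finset.eqEsubset JK.
  have Ga : parabolic full (g *m a).
    by apply: paraM => //; apply: paraS Ja; apply: finset.subsetT.
  have gwJ := reachableU gJ wJ tw.
  have [|||e'|e'] := cov (translate (g *m a) (face (w |: J))).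
  - by apply/reachable_facesP; exists (g *m a), (w |: J).
  - by rewrite eg; apply/translateS/faceS/finset.subsetUr.
  - by rewrite eh; apply/translateS/faceS; rewrite finset.subUset finset.sub1set wK.
  - have [eJ _] := (face_eqP Ga Gg gwJ gJ).1 e'.
    by rewrite -eJ setU11 in wJ.
  - have [eJ _] := (face_eqP Ga Gh gwJ gK).1 e'.
    by exists w.
move=> [[w [wJ tw e]] meet]; have JK : J \subset K by rewrite e finset.subsetUr.
split.
- by apply/reachable_facesP; exists g, J.
- by apply/reachable_facesP; exists h, K.
- exact/face_subP.
- move=> /(face_eqP Gg Gh gJ gK)[eJ _].
  by rewrite eJ e setU11 in wJ.
move=> C /reachable_facesP[l [L [Gl gL ->]]] sub1 sub2.
have [JL _] := (face_subP Gg Gl gJ gL).1 sub1.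
have [LK _] := (face_subP Gl Gh gL gK).1 sub2.
have [wL|wL] := boolP (w \in L).
  right; have eL : L = K.
    by apply/eqP; rewrite finset.eqEsubset LK e finset.subUset finset.sub1set wL.
  by rewrite eL in gL sub2 *; apply: face_sub_eq.
left; have eL : L = J.
  apply/eqP; rewrite finset.eqEsubset JL andbT; apply/fintype.subsetP => i iL.
  have := fintype.subsetP LK i iL; rewrite e in_setU1 => /orP[/eqP iw|//].
  by rewrite -iw iL in wL.
by rewrite eL in gL sub1 *; apply/esym/face_sub_eq.
Qed.

Lemma wythoff_face_lattice :
  exists phi : set 'cV[R]_n -> wpair R n,
    [/\ set_bij (nonempty_faces (face full)) (wpairs v m f) phi,
        forall F k, nonempty_faces (face full) F ->
          (has_aff_dim F k <-> wpairs_of_rank v m f k (phi F)),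
        forall F F', nonempty_faces (face full) F -> nonempty_faces (face full) F' ->
          (F `<=` F' <-> wpair_le v m f (phi F) (phi F'))
      & forall F F', nonempty_faces (face full) F -> nonempty_faces (face full) F' ->
          (order_cover (nonempty_faces (face full)) subset F F' <->
           wpair_cover v m f (phi F) (phi F'))].
Proof.
have [phi phiP] : exists phi : set 'cV[R]_n -> wpair R n, forall g J,
    parabolic full g -> reachable J -> phi (translate g (face J)) = wpair_of g J.
  have /choice[phi phiP] : forall F, exists p : wpair R n, nonempty_faces (face full) F ->
      exists g J, [/\ parabolic full g, reachable J, F = translate g (face J) & p = wpair_of g J].
    move=> F; have [/reachable_facesP[g [J [Gg gJ ->]]]|nF] := pselect (nonempty_faces (face full) F).
      by exists (wpair_of g J) => _; exists g, J.
    by exists (set0, deco finset.set0).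
  exists phi => g J Gg gJ; have [|h [K [Gh gK e ->]]] := phiP (translate g (face J)).
    by apply/reachable_facesP; exists g, J.
  exact/wpair_of_eq.
exists phi; split.
- split.
  + move=> _ /reachable_facesP[g [J [Gg gJ ->]]]; rewrite phiP //.
    by apply/wpairsP; exists g, J.
  + move=> F F' /set_mem/reachable_facesP[g [J [Gg gJ ->]]] /set_mem/reachable_facesP[h [K [Gh gK ->]]].
    by rewrite !phiP // => /wpair_of_eq; apply.
  + move=> _ /wpairsP[g [J [Gg gJ ->]]]; exists (translate g (face J)); last exact: phiP.
    by apply/reachable_facesP; exists g, J.
- move=> _ k /reachable_facesP[g [J [Gg gJ ->]]]; rewrite phiP // face_dim //; split.
    by move=> ->; apply/wpairs_of_rankP; exists g, J.
  by move=> /wpairs_of_rankP[h [K [_ _ <- [_ /deco_inj ->]]]].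
- move=> _ _ /reachable_facesP[g [J [Gg gJ ->]]] /reachable_facesP[h [K [Gh gK ->]]].
  by rewrite !phiP //; apply: wpair_leP.
- move=> _ _ /reachable_facesP[g [J [Gg gJ ->]]] /reachable_facesP[h [K [Gh gK ->]]].
  by rewrite !phiP //; apply: order_coverP.
Qed.

End Coxeter.

Theorem theorem9 (R : realType) (n : nat) (v : 'I_n -> 'cV[R]_n) (m : 'M[nat]_n)
    (f : decoration n 'I_2) (x : 'cV[R]_n)
    (n_ge1 : (1 <= n)%N)
    (v_free : free [seq v i | i <- enum 'I_n])
    (v_unit : forall i, enorm (v i) = 1)
    (m_sym : forall i j, m i j = m j i)
    (m_diag : forall i, m i i = 1%N)
    (m_offdiag : forall i j : 'I_n, i != j -> (2 <= m i j)%N)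
    (v_dot : forall i j, dot (v i) (v j) = - cos (pi / (m i j)%:R))
    (G_finite : finite_set (refl_group v setT))
    (f_nondeg : deco_nondegenerate m f)
    (x_wythoff : wythoff_point v f x) :
  exists phi : set 'cV[R]_n -> wpair R n,
    [/\ set_bij (nonempty_faces (wythoff_polytope v x)) (wpairs v m f) phi,
        forall F k, nonempty_faces (wythoff_polytope v x) F ->
          (has_aff_dim F k <-> wpairs_of_rank v m f k (phi F)),
        forall F F', nonempty_faces (wythoff_polytope v x) F ->
          nonempty_faces (wythoff_polytope v x) F' ->
          (F `<=` F' <-> wpair_le v m f (phi F) (phi F'))
      & forall F F', nonempty_faces (wythoff_polytope v x) F ->
          nonempty_faces (wythoff_polytope v x) F' ->
          (order_cover (nonempty_faces (wythoff_polytope v x)) subset F F' <->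
           wpair_cover v m f (phi F) (phi F'))].
Proof.
have [_ [c [c0 xP]]] := x_wythoff; rewrite (full_group v_unit) in G_finite.
have f01 i : f i = 0%N :> nat \/ f i = 1%N :> nat.
  by case: (f i) => -[|[|]] // ?; [left | right].
have x_dom i : 0 <= dot (v i) x.
  by have [x0 x1] := xP i; case: (f01 i) => [/x0|/x1] ->; rewrite // ltW.
have f_x i : (dot (v i) x != 0) = (f i == 1%N :> nat).
  have [x0 x1] := xP i; case: (f01 i) => e; rewrite e ?(x0 e) ?(x1 e) ?eqxx //.
  by rewrite gt_eqF.
rewrite /wythoff_polytope (full_group v_unit) -/(face v x [set: 'I_n]%SET).
exact: wythoff_face_lattice f_x.
Qed.
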